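(* Let $G=(V,E,m,\mu)$ be a complete weighted graph with a non-degenerate measure $m$, i.e. $\inf_{x\in V}m(x)>0$, and let $K\in\mathbb{R}$. Then the following are equivalent: (a) $G$ satisfies the curvature dimension condition $\mathrm{CD}(K,\infty)$. (b) For every $f\in C_0(V)$ and every $t\ge0$, $\Gamma(P_t f)\leq e^{-2Kt}P_t(\Gamma (f))$ pointwise on $V$. (c) For every $f\in D(Q)$ and every $t\ge0$, $\Gamma(P_t f)\leq e^{-2Kt}P_t(\Gamma (f))$ pointwise on $V$.
   Context: Weighted graphs: $(V,E)$ is a (finite or infinite) undirected, connected, locally finite graph (every vertex has finitely many neighbors; self-loops are allowed); $x\sim y$ means $(x,y)\in E$. $\mu:E\to(0,\infty)$, $(x,y)\mapsto\mu_{xy}$, is symmetric and extended by $\mu_{xy}=0$ if $x\not\sim y$; $m:V\to(0,\infty)$ is a measure on $V$. The quadruple $G=(V,E,m,\mu)$ is called a weighted graph. $C_0(V)$ is the set of finitely supported functions $V\to\mathbb{R}$; $\ell^p_m=\ell^p(V,m)$. Formal Laplacian, for all $f:V\to\mathbb{R}$: $\Delta f(x)=\frac{1}{m(x)}\sum_{y}\mu_{xy}(f(y)-f(x))$. $\Gamma$-calculus: $\Gamma(f,g)(x)=\frac12(\Delta(fg)-f\Delta g-g\Delta f)(x)=\frac{1}{2m(x)}\sum_y\mu_{xy}(f(y)-f(x))(g(y)-g(x))$, $\Gamma(f)=\Gamma(f,f)$; $\Gamma_2(f)=\frac12\Delta\Gamma(f)-\Gamma(f,\Delta f)$. $\mathrm{CD}(K,\infty)$: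 $\Gamma_2(f)(x)\ge K\Gamma(f)(x)$ for all $f:V\to\mathbb{R}$ and all $x\in V$. Complete graph: there is a nondecreasing sequence $\{\eta_k\}_{k=1}^\infty\subset C_0(V)$ with $\lim_{k\to\infty}\eta_k=\mathds{1}$ pointwise ($\mathds{1}$ the constant function $1$) and $\Gamma(\eta_k)\le\frac1k$ on $V$ for every $k$. Dirichlet form and heat semigroup: $Q(f,g)=\frac12\sum_{x,y\in V}\mu_{xy}(f(y)-f(x))(g(y)-g(x))$ with domain $D(Q)$ the completion of $C_0(V)$ under $\|f\|_Q=\left(\|f\|_{\ell^2_m}^2+\frac12\sum_{x,y}\mu_{xy}(f(y)-f(x))^2\right)^{1/2}$; for complete graphs $D(Q)=\{f\in\ell^2_m:\sum_{x,y}\mu_{xy}(f(y)-f(x))^2<\infty\}$. $Q$ is a Dirichlet form on $\ell^2_m$. Its generator is the self-adjoint operator $L$ on $\ell^2_m$ with $-L\ge0$ and $Q(f,g)=\langle(-L)^{1/2}f,(-L)^{1/2}g\rangle$; $L$ acts as $\Delta$ on its domain. $P_t=e^{tL}$ is the associated semigroup on $\ell^2_m$, which extends to $\ell^p_m$ for all $p\in[1,\infty]$ (explicitly, $P_tf(x)=\sum_y p_t(x,y)f(y)m(y)$ with heat kernel $p_t(x,y)=m(y)^{-1}(P_t\delta_y)(x)$, where $\delta_y$ is the indicator function of $\{y\}$). *)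

(* Defs.v *)
From mathcomp Require Import all_boot all_order all_algebra.
From mathcomp Require Import all_classical all_reals all_analysis.

Set Implicit Arguments.
Unset Strict Implicit.
Unset Printing Implicit Defensive.

Import Order.TTheory GRing.Theory Num.Theory.
Import numFieldNormedType.Exports.

Local Open Scope classical_set_scope.
Local Open Scope ring_scope.

Record weightedGraph (R : realType) := WeightedGraph {
  vertex :> choiceType;
  edge : rel vertex;
  edge_sym : symmetric edge;
  edge_locally_finite : forall x, finite_set [set y | edge x y];
  edge_connected : forall x y, exists2 p : seq vertex, path edge x p & last x p = y;
  mu : vertex -> vertex -> R;
  mu_sym : forall x y, mu x y = mu y x;
  mu_gt0 : forall x y, edge x y -> 0 < mu x y;
  mu_eq0 : forall x y, ~~ edge x y -> mu x y = 0;
  m : vertex -> R;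
  m_gt0 : forall x, 0 < m x }.

Arguments edge {R w}.
Arguments mu {R w}.
Arguments m {R w}.

(* Unordered sum of a signed family. It is the usual sum when the family is
   absolutely summable, and is only meant to be used in that case. *)
Definition usum (R : realType) (I : choiceType) (a : I -> R) : R :=
  fine (esum setT ((EFin \o a)^\+)%E - esum setT ((EFin \o a)^\-)%E)%E.

Section Graph.
Context {R : realType} {G : weightedGraph R}.
Implicit Types f g : G -> R.

Definition nondegenerate_measure := (0 < ereal_inf (range (fun x : G => (m x)%:E)))%E.

Definition C0 f := finite_set [set x | f x != 0].

(* For fixed x only the finitely many neighbours of x contribute. *)
Definition laplacian f (x : G) : R :=
  (m x)^-1 * \sum_(y \in [set: G]) mu x y * (f y - f x).

Definition Gamma f g (x : G) : R :=
  2^-1 * (laplacian (f \* g) x - f x * laplacian g x - g x * laplacian f x).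

Definition Gamma2 f (x : G) : R :=
  2^-1 * laplacian (Gamma f f) x - Gamma f (laplacian f) x.

(* The sequence is indexed from 0 here and from 1 in the source, whence 1/(k+1). *)
Definition complete_graph := exists eta : nat -> G -> R,
  [/\ forall k, C0 (eta k),
      forall k x, eta k x <= eta k.+1 x,
      forall x, eta k x @[k --> \oo] --> (1 : R)
    & forall k x, Gamma (eta k) (eta k) x <= k.+1%:R^-1].

Definition l2_normsq f : \bar R := (\esum_(x in [set: G]) (m x * f x ^+ 2)%:E)%E.

Definition l2 f := (l2_normsq f < +oo)%E.

Definition l2_dot f g : R := usum (fun x : G => m x * f x * g x).

Definition energy f : \bar R :=
  ((2^-1)%:E *
   \esum_(p in [set: G * G]) (mu p.1 p.2 * (f p.2 - f p.1) ^+ 2)%:E)%E.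

Definition Q f g : R :=
  2^-1 * usum (fun p : G * G => mu p.1 p.2 * (f p.2 - f p.1) * (g p.2 - g p.1)).

Definition Q_normsq f : \bar R := (l2_normsq f + energy f)%E.

(* The functions f : V -> R with |f|_Q finite form a Hilbert space, so the
   completion of C0 is realized as the closure of C0 there; |f - phi n|_Q
   tending to 0 forces |f|_Q to be finite. *)
Definition DQ f := exists2 phi : nat -> G -> R,
  forall n, C0 (phi n) & Q_normsq (f \- phi n) @[n --> \oo] --> 0%E.

End Graph.

Arguments nondegenerate_measure {R} G.
Arguments complete_graph {R} G.

Definition CD {R : realType} (G : weightedGraph R) (K : R) :=
  forall (f : G -> R) (x : G), K * Gamma f f x <= Gamma2 f x.

(* A possibly unbounded linear operator on l2; the values of [app] outside of
   [dom] are irrelevant. *)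
Record l2_operator (R : realType) (G : weightedGraph R) := L2Operator {
  dom : set (G -> R);
  app :> (G -> R) -> G -> R;
  dom_l2 : forall f, dom f -> l2 f;
  app_l2 : forall f, dom f -> l2 (app f);
  dom0 : dom (fun=> 0);
  dom_linear : forall a f g, dom f -> dom g -> dom (fun x => a * f x + g x);
  app_linear : forall a f g, dom f -> dom g ->
    app (fun x => a * f x + g x) = (fun x => a * app f x + app g x) }.

Section Operators.
Context {R : realType} {G : weightedGraph R}.
Implicit Types A L S : l2_operator G.

Definition densely_defined A := forall f : G -> R, l2 f ->
  forall e : R, 0 < e -> exists2 g, dom A g & (l2_normsq (f \- g)%R < e%:E)%E.

Definition adjoint_graph A (g h : G -> R) :=
  [/\ l2 g, l2 h & forall f, dom A f -> l2_dot (A f) g = l2_dot f h].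

Definition self_adjoint A := densely_defined A /\
  forall g h, adjoint_graph A g h <-> dom A g /\ A g = h.

Definition nonnegative A := forall f, dom A f -> 0 <= l2_dot (A f) f.

(* S = (-L)^(1/2) *)
Definition sqrt_opp S L :=
  [/\ self_adjoint S, nonnegative S,
      forall f, dom L f <-> dom S f /\ dom S (S f)
    & forall f, dom L f -> forall x, S (S f) x = - L f x].

Definition form_generator L :=
  [/\ self_adjoint L,
      forall f, dom L f -> l2_dot (L f) f <= 0
    & exists S, [/\ sqrt_opp S L, dom S = DQ
        & forall f g, DQ f -> DQ g -> Q f g = l2_dot (S f) (S g)]].

(* Strongly continuous semigroups of bounded operators on l2, indexed by
   t >= 0; values at t < 0 or outside of l2 are irrelevant. *)
Definition C0_semigroup (T : R -> (G -> R) -> G -> R) :=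
  [/\ forall t, 0 <= t -> exists C : R, forall f, l2 f ->
        (l2_normsq (T t f) <= C%:E * l2_normsq f)%E,
      forall t, 0 <= t -> forall a f g, l2 f -> l2 g ->
        T t (fun x => a * f x + g x) = (fun x => a * T t f x + T t g x),
      forall f, l2 f -> T 0 f = f,
      forall s t, 0 <= s -> 0 <= t ->
        forall f, l2 f -> T (s + t) f = T s (T t f)
    & forall f, l2 f -> l2_normsq (T t f \- f) @[t --> 0^'+] --> 0%E].

(* T t = e^(tL): T is the strongly continuous semigroup on l2 whose
   infinitesimal generator is exactly L, domain included. *)
Definition exp_semigroup L (T : R -> (G -> R) -> G -> R) :=
  C0_semigroup T /\
  forall f h, l2 f -> l2 h ->
    (l2_normsq (fun x => t^-1 * (T t f x - f x) - h x) @[t --> 0^'+] --> 0%E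
     <-> dom L f /\ L f = h).

Definition heat_kernel (T : R -> (G -> R) -> G -> R) (t : R) (x y : G) : R :=
  (m y)^-1 * T t (fun z => (z == y)%:R) x.

(* Extension to all the spaces l^p of the semigroup T on l2. *)
Definition heat (T : R -> (G -> R) -> G -> R) (t : R) (f : G -> R) (x : G) : R :=
  usum (fun y : G => heat_kernel T t x y * f y * m y).

End Operators.

(* Main.v *)
(* Since [inf m > 0], [l1] embeds in [l2], so [Gamma f] is in [l2] for [f] of finite
   energy and the whole argument takes place in [l2].

   CD => (b): for [f] of finite support put [u s = P_s f], [w s = Gamma (u s)] and
   [z s = e^(-2Ks) P_s (Gamma f) - w s], so that [z 0 = 0].  CD reads
   [laplacian w >= 2 K w + 2 Gamma (u, L u)] pointwise.  On a complete graph a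
   Caccioppoli estimate shows that such a [w] has finite energy and that the
   inequality holds weakly against nonnegative functions of [D(Q)]; hence
   [<z', z^-> >= 2K |z^-|^2], and a maximum principle gives [z >= 0].
   (b) => (c): multiply [f] by the cutoffs [eta_k] and pass to the limit.
   (c) => CD: [z 0 = 0] and [z >= 0] force [z' 0 = 2 (Gamma2 f - K Gamma f) >= 0], and
   [Gamma2 f x] only depends on [f] on the ball of radius 2 around [x]. *)

Require Import Defs.
From mathcomp Require Import all_boot all_order all_algebra.
From mathcomp Require Import all_classical all_reals all_analysis.
From mathcomp Require Import finmap ring lra.
Import Order.TTheory GRing.Theory Num.Theory.
Import numFieldNormedType.Exports.

Set Implicit Arguments.
Unset Strict Implicit.
Unset Printing Implicit Defensive.

Local Open Scope classical_set_scope.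
Local Open Scope ring_scope.

(** * Unordered sums *)

(** The usual interpolation differentiates [P_(t-s) Gamma (P_s f)] in [s], which requires the
    semigroup to act on [laplacian (Gamma (P_s f))], a function about which CD gives only a lower
    bound. Comparing two evolutions at the same time and testing with [z^-] asks only for finite
    energy of [Gamma (P_s f)], and a lower bound on the Laplacian is what a Caccioppoli estimate
    uses.

    The semigroup is given by boundedness at each time, right continuity at 0 and its generator.
    Left continuity therefore comes from a Baire argument, positivity from the maximum principle
    itself, and time derivatives stay one-sided. Gradients are controlled through the graph norm of
    [L], because [2 Q(f,f) = - 2 <L f, f> <= |f|^2 + |L f|^2]. Finite support of the initial
    function puts [f], [L f] and [Gamma f] all in the domain of [L]. Finally [heat] is a kernel sum,
    and positivity is also what identifies it with the semigroup on [l2]. *)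

Section UnorderedSums.
Context {R : realType} {I : choiceType}.
Implicit Types a b : I -> R.

Local Notation asum a := (\esum_(i in [set: I]) (a i)%:E)%E.
Local Notation abs_summable a := (summable [set: I] (EFin \o a)).

Lemma abs_summable_le a b : (forall i, `|a i| <= b i) -> (asum b < +oo)%E ->
  abs_summable a.
Proof. by move=> ab; apply: le_lt_trans; apply: le_esum => i _; rewrite lee_fin. Qed.

Lemma abs_summable_ge0 a : (forall i, 0 <= a i) -> abs_summable a ->
  asum a \is a fin_num.
Proof.
move=> a0; rewrite summableE (@eq_esum _ _ _ _ (EFin \o a))// => i _ /=.
by rewrite ger0_norm.
Qed.

Lemma usumB_ge0 a b : (forall i, 0 <= a i) -> (forall i, 0 <= b i) ->
    abs_summable a -> abs_summable b ->
  usum (fun i => a i - b i) = fine (asum a) - fine (asum b).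
Proof.
move=> a0 b0 sa sb; rewrite -fineB ?abs_summable_ge0//.
congr fine; rewrite -[RHS](@esumB _ _ setT (EFin \o a) (EFin \o b))//.
- by move=> i _; rewrite lee_fin.
- by move=> i _; rewrite lee_fin.
Qed.

Lemma ge0_usumE a : (forall i, 0 <= a i) -> usum a = fine (asum a).
Proof.
move=> a0; rewrite /usum [X in (_ - X)%E](_ : _ = 0%E) ?sube0; last first.
  apply: esum1 => i _; rewrite funenegE /=; apply/max_idPr.
  by rewrite lee_fin oppr_le0.
congr fine; apply: eq_esum => i _; rewrite funeposE /=; apply/max_idPl.
by rewrite lee_fin.
Qed.

Lemma ge0_usum_esum a : (forall i, 0 <= a i) -> (asum a < +oo)%E ->
  (usum a)%:E = asum a.
Proof.
move=> a0 sa; rewrite ge0_usumE// fineK// abs_summable_ge0//.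
by apply: abs_summable_le sa => i; rewrite ger0_norm.
Qed.

Lemma abs_summableD a b : abs_summable a -> abs_summable b ->
  abs_summable (a \+ b).
Proof. by move=> sa sb; exact: (summableD sa sb). Qed.

Let pos a i : R := Num.max (a i) 0.
Let neg a i : R := Num.max (- a i) 0.

Let pos_ge0 a i : 0 <= pos a i. Proof. by rewrite /pos le_max lexx orbT. Qed.
Let neg_ge0 a i : 0 <= neg a i. Proof. by rewrite /neg le_max lexx orbT. Qed.
Let posBneg a i : pos a i - neg a i = a i.
Proof.
rewrite /pos /neg; have [ai0|ai0] := leP 0 (a i).
  by rewrite max_r ?oppr_le0// subr0.
by rewrite max_l ?sub0r ?opprK// oppr_ge0 ltW.
Qed.

Let le_asum_summable a b : (forall i, `|a i| <= `|b i|) ->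
  abs_summable b -> abs_summable a.
Proof. by move=> ab; apply: le_lt_trans; apply: le_esum => i _; rewrite lee_fin. Qed.

Let pos_summable a : abs_summable a -> abs_summable (pos a).
Proof.
apply: le_asum_summable => i; rewrite (ger0_norm (pos_ge0 _ _)) /pos ge_max.
by rewrite normr_ge0 ler_norm.
Qed.
Let neg_summable a : abs_summable a -> abs_summable (neg a).
Proof.
apply: le_asum_summable => i; rewrite (ger0_norm (neg_ge0 _ _)) /neg ge_max.
by rewrite normr_ge0 -normrN ler_norm.
Qed.

Let usum_pos_neg a : abs_summable a ->
  usum a = fine (asum (pos a)) - fine (asum (neg a)).
Proof.
move=> sa; rewrite -usumB_ge0; [|exact: pos_ge0|exact: neg_ge0
  |exact: pos_summable|exact: neg_summable].
by congr usum; apply/funext => i; rewrite posBneg.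
Qed.

Lemma usumD a b : abs_summable a -> abs_summable b ->
  usum (fun i => a i + b i) = usum a + usum b.
Proof.
move=> sa sb.
have -> : (fun i => a i + b i) =
    (fun i => (pos a i + pos b i) - (neg a i + neg b i)).
  by apply/funext => i; rewrite -(posBneg a i) -(posBneg b i); ring.
rewrite usumB_ge0; first last.
- exact/abs_summableD/neg_summable/sb/neg_summable.
- exact/abs_summableD/pos_summable/sb/pos_summable.
- by move=> i; rewrite addr_ge0.
- by move=> i; rewrite addr_ge0.
rewrite (usum_pos_neg sa) (usum_pos_neg sb).
under eq_esum do rewrite EFinD.
under [X in _ - fine X = _]eq_esum do rewrite EFinD.
have P c : abs_summable c -> asum (pos c) \is a fin_num.
  by move=> sc; apply: abs_summable_ge0 => //; exact: pos_summable.
have N c : abs_summable c -> asum (neg c) \is a fin_num.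
  by move=> sc; apply: abs_summable_ge0 => //; exact: neg_summable.
rewrite !esumD//; try by move=> i _; rewrite lee_fin.
by rewrite !fineD; [ring|exact: N..|exact: P|exact: P].
Qed.

Lemma esumZ a k : (forall i, 0 <= a i) -> 0 <= k ->
  asum (fun i => k * a i) = (k%:E * asum a)%E.
Proof.
(* The sum may be [+oo]: the case [k = 0] rests on [0 * +oo = 0], the other one divides by [k]. *)
move=> a0; rewrite le_eqVlt => /predU1P[<-|k0].
  by rewrite mul0e esum1// => i _; rewrite mul0r.
apply/eqP; rewrite eq_le; apply/andP; split.
  apply: ge_ereal_sup => _ [X [finX _] <-].
  rewrite fsbig_finite//= sumEFin -mulr_sumr EFinM lee_pmul2l//.
  apply: esum_ge; exists X => //.
  by rewrite fsbig_finite//= sumEFin.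
rewrite -lee_pdivlMl//; apply: ge_ereal_sup => _ [X [finX _] <-].
rewrite lee_pdivlMl//; apply: esum_ge; exists X => //.
by rewrite !fsbig_finite//= !sumEFin -EFinM mulr_sumr.
Qed.

Lemma abs_summableZ a k : abs_summable a -> abs_summable (fun i => k * a i).
Proof.
move=> sa; rewrite /summable (@eq_esum _ _ _ _ (fun i => (`|k| * `|a i|)%:E)).
  by rewrite esumZ//; exact: lte_mul_pinfty.
by move=> i _ /=; rewrite normrM.
Qed.

Lemma usumN a : usum (fun i => - a i) = - usum a.
Proof.
have E (b c : \bar R) : (0 <= b)%E -> (0 <= c)%E ->
    fine (b - c)%E = - fine (c - b)%E :> R.
  by case: b c => [b| |] [c| |]//= _ _; rewrite ?oppr0// opprB.
rewrite /usum; have -> : EFin \o (fun i => - a i) = (\- (EFin \o a))%E.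
  by apply/funext.
by rewrite funeposN funenegN; apply: E; apply: esum_ge0 => i _.
Qed.

Lemma usumZ a k : abs_summable a -> usum (fun i => k * a i) = k * usum a.
Proof.
suff H c : 0 <= c -> abs_summable a -> usum (fun i => c * a i) = c * usum a.
  move=> sa; have [k0|k0] := leP 0 k; first exact: H.
  rewrite -[k]opprK mulNr -H ?oppr_ge0 1?ltW// -usumN.
  by congr usum; apply/funext => i; ring.
move=> c0 sa; rewrite (usum_pos_neg sa).
have -> : (fun i => c * a i) = (fun i => c * pos a i - c * neg a i).
  by apply/funext => i; rewrite -mulrBr posBneg.
rewrite usumB_ge0.
- by rewrite !esumZ// !fineM ?abs_summable_ge0//
    ?mulrBr//; [exact: neg_summable|exact: pos_summable].
- by move=> i; rewrite mulr_ge0.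
- by move=> i; rewrite mulr_ge0.
- exact/abs_summableZ/pos_summable.
- exact/abs_summableZ/neg_summable.
Qed.

Lemma usum_ge0 a : (forall i, 0 <= a i) -> 0 <= usum a.
Proof.
by move=> a0; rewrite ge0_usumE//; apply/fine_ge0/esum_ge0 => i _; rewrite lee_fin.
Qed.

Lemma esum_finite_support a (X : {fset I}) : (forall i, 0 <= a i) ->
  (forall i, i \notin X -> a i = 0) -> asum a = (\sum_(i <- X) a i)%:E.
Proof.
move=> a0 aX; have -> : asum a = (\esum_(i in [set` X]) (a i)%:E)%E.
  rewrite [RHS]esum_mkcond; apply: eq_esum => i _; rewrite mem_setE.
  by case: ifPn => // /aX ->.
rewrite esum_fset//; last by move=> i _; rewrite lee_fin.
by rewrite fsbig_finite//= set_fsetK sumEFin.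
Qed.

Lemma abs_summable_finite_support a (X : {fset I}) :
  (forall i, i \notin X -> a i = 0) -> abs_summable a.
Proof.
move=> aX; rewrite /summable/= (@esum_finite_support (fun i => `|a i|) X)//.
  by rewrite ltry.
by move=> i /aX ->; rewrite normr0.
Qed.

Lemma usum_finite_support a (X : {fset I}) :
  (forall i, i \notin X -> a i = 0) -> usum a = \sum_(i <- X) a i.
Proof.
move=> aX; rewrite usum_pos_neg; last exact: abs_summable_finite_support aX.
rewrite !(@esum_finite_support _ X)//=.
- by rewrite -sumrB; apply: eq_bigr => i _; rewrite posBneg.
- by move=> i /aX; rewrite /neg => ->; rewrite oppr0 maxxx.
- by move=> i /aX; rewrite /pos => ->; rewrite maxxx.
Qed.

End UnorderedSums.

(** * Weighted l2 spaces *)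

Section ConvergenceToZero.
Context {R : realType} {T : Type} {F : set_system T} {FF : Filter F}.
Implicit Types f g : T -> \bar R.

(** Norms are extended reals that may be infinite away from the limit; this form lets them be
    compared without finiteness side conditions. *)
Lemma cvge0P f : (forall r, 0 <= f r)%E ->
  f @ F --> 0%E <-> forall e : R, 0 < e -> \forall r \near F, (f r <= e%:E)%E.
Proof.
move=> f0; split=> [/fine_cvgP[ffin /cvgr0Pnorm_le f_to0] e e0|f_small].
  near=> r.
  have fr : f r \is a fin_num by near: r.
  rewrite -(fineK fr) lee_fin -[leLHS]ger0_norm ?fine_ge0//.
  by near: r; exact: f_to0.
apply/fine_cvgP; split.
  near=> r; rewrite ge0_fin_numE//.
  by apply: (@le_lt_trans _ _ 1%:E); rewrite ?ltry//; near: r; exact: f_small.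
apply/cvgr0Pnorm_le => e e0; near=> r.
rewrite ger0_norm ?fine_ge0// -lee_fin fineK.
  by near: r; exact: f_small.
rewrite ge0_fin_numE//.
by apply: (@le_lt_trans _ _ 1%:E); rewrite ?ltry//; near: r; exact: f_small.
Unshelve. all: by end_near. Qed.

Lemma cvge0_le f g (k : R) : (forall r, 0 <= f r)%E -> (forall r, 0 <= g r)%E ->
    (\forall r \near F, f r <= k%:E * g r)%E -> g @ F --> 0%E -> f @ F --> 0%E.
Proof.
move=> f0 g0 fg /(cvge0P g0) g_small; apply/(cvge0P f0) => e e0.
have k1 : 0 < `|k| + 1 by rewrite ltr_wpDl.
near=> r; apply: (@le_trans _ _ (k%:E * g r)%E); first by near: r.
apply: (@le_trans _ _ ((`|k| + 1)%:E * g r)%E).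
  by rewrite lee_wpmul2r// lee_fin ler_wpDr// ler_norm.
have -> : e = (`|k| + 1) * (e / (`|k| + 1)) by field; rewrite gt_eqF.
rewrite EFinM lee_pmul2l//.
by near: r; apply: g_small; rewrite divr_gt0.
Unshelve. all: by end_near. Qed.

Lemma cvge0D f g : (forall r, 0 <= f r)%E -> (forall r, 0 <= g r)%E ->
  f @ F --> 0%E -> g @ F --> 0%E -> (fun r => f r + g r)%E @ F --> 0%E.
Proof.
move=> f0 g0 /(cvge0P f0) f_small /(cvge0P g0) g_small.
apply/cvge0P => [r|e e0]; first by rewrite adde_ge0.
near=> r; rewrite [e]splitr EFinD.
by apply: leeD; near: r; [apply: f_small|apply: g_small]; rewrite divr_gt0.
Unshelve. all: by end_near. Qed.

End ConvergenceToZero.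

Lemma quadratic_ge0_discr (R : realType) (a b c : R) : 0 <= c ->
  (forall t, 0 <= a + 2 * t * b + t ^+ 2 * c) -> b ^+ 2 <= a * c.
Proof.
move=> c_ge0 pos; have a0 : 0 <= a by have := pos 0; lra.
have [c0|c0] := eqVneq c 0.
  have [->|b0] := eqVneq b 0; first by rewrite c0; lra.
  (* For [c = 0] the polynomial is affine in [t], and this [t] gives it the value [-1]. *)
  have := pos (- (a + 1) / (2 * b)).
  have -> : a + 2 * (- (a + 1) / (2 * b)) * b + (- (a + 1) / (2 * b)) ^+ 2 * c
    = -1 by rewrite c0; field.
  by lra.
have := pos (- b / c).
have -> : a + 2 * (- b / c) * b + (- b / c) ^+ 2 * c = a - b ^+ 2 / c by field.
by rewrite subr_ge0 ler_pdivrMr// lt_neqAle eq_sym c0.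
Qed.

Section WeightedL2.
Context {R : realType} {I : choiceType} (c : I -> R).
Hypothesis c_ge0 : forall i, 0 <= c i.
Implicit Types f g h : I -> R.

(* [l2_normsq] and [l2_dot] are the case [c = m]; [energy] and [Q] are half of the
   case [c = mu], evaluated at the differences [f y - f x]. *)
Definition wsq f : \bar R := (\esum_(i in [set: I]) (c i * f i ^+ 2)%:E)%E.
Definition wdot f g : R := usum (fun i => c i * f i * g i).

Lemma wsq_term_ge0 f i : 0 <= c i * f i ^+ 2.
Proof. by rewrite mulr_ge0// sqr_ge0. Qed.

Lemma wsq_ge0 f : (0 <= wsq f)%E.
Proof. by apply: esum_ge0 => i _; rewrite lee_fin wsq_term_ge0. Qed.

Lemma wsq_le f g : (forall i, `|f i| <= `|g i|) -> (wsq f <= wsq g)%E.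
Proof.
move=> fg; apply: le_esum => i _; rewrite lee_fin ler_wpM2l//.
by rewrite -(real_normK (num_real (f i))) -(real_normK (num_real (g i))) ler_sqr ?nnegrE.
Qed.

Lemma wsqZ k f : wsq (fun i => k * f i) = ((k ^+ 2)%:E * wsq f)%E.
Proof.
rewrite -esumZ ?sqr_ge0// ; last exact: wsq_term_ge0.
by apply: eq_esum => i _; congr EFin; ring.
Qed.

Lemma wsqN f : wsq (fun i => - f i) = wsq f.
Proof. by apply: eq_esum => i _; rewrite sqrrN. Qed.

Lemma wsqB_sym f g : wsq (f \- g)%R = wsq (g \- f)%R.
Proof. by rewrite -wsqN; congr wsq; apply/funext => i /=; rewrite opprB. Qed.

Lemma wsqD_le f g : (wsq (fun i => f i + g i)%R <= 2%:E * wsq f + 2%:E * wsq g)%E.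
Proof.
rewrite -!esumZ//; try exact: wsq_term_ge0.
rewrite -esumD; try by move=> i _; rewrite lee_fin mulr_ge0 ?wsq_term_ge0.
apply: le_esum => i _; rewrite -EFinD lee_fin.
have -> : 2 * (c i * f i ^+ 2) + 2 * (c i * g i ^+ 2) =
  c i * (2 * f i ^+ 2 + 2 * g i ^+ 2) by ring.
by rewrite ler_wpM2l//; have := sqr_ge0 (f i - g i); nra.
Qed.

Lemma wsqD_lty f g : (wsq f < +oo)%E -> (wsq g < +oo)%E ->
  (wsq (fun i => f i + g i)%R < +oo)%E.
Proof.
move=> ff fg; apply: le_lt_trans (wsqD_le f g) _.
by rewrite lte_add_pinfty// lte_mul_pinfty.
Qed.

Lemma wsqZ_lty k f : (wsq f < +oo)%E -> (wsq (fun i => k * f i)%R < +oo)%E.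
Proof. by move=> ff; rewrite wsqZ lte_mul_pinfty// lee_fin sqr_ge0. Qed.

Lemma wsqB_lty f g : (wsq f < +oo)%E -> (wsq g < +oo)%E -> (wsq (f \- g)%R < +oo)%E.
Proof. by move=> ff fg; apply: (wsqD_lty ff (g := fun i => - g i)); rewrite wsqN. Qed.

Lemma wdot_summable f g : (wsq f < +oo)%E -> (wsq g < +oo)%E ->
  summable [set: I] (EFin \o (fun i => c i * f i * g i)).
Proof.
move=> ff fg; apply: (@abs_summable_le _ _ _ (fun i => c i * f i ^+ 2 + c i * g i ^+ 2)).
  move=> i; rewrite -mulrA normrM (ger0_norm (c_ge0 i)) -mulrDr ler_wpM2l//.
  rewrite normrM -[X in _ <= X + _]real_normK ?num_real//.
  rewrite -[X in _ <= _ + X]real_normK ?num_real//.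
  by have := sqr_ge0 (`|f i| - `|g i|); have := normr_ge0 (f i);
    have := normr_ge0 (g i); nra.
under eq_esum do rewrite EFinD.
rewrite esumD; try by move=> i _; rewrite lee_fin wsq_term_ge0.
by rewrite lte_add_pinfty.
Qed.

Lemma wdotC f g : wdot f g = wdot g f.
Proof. by congr usum; apply/funext => i; ring. Qed.

Lemma wdotZl k f g : (wsq f < +oo)%E -> (wsq g < +oo)%E ->
  wdot (fun i => k * f i) g = k * wdot f g.
Proof.
move=> ff fg; rewrite -usumZ; last exact: wdot_summable.
by congr usum; apply/funext => i; ring.
Qed.

Lemma wdotDl f g h : (wsq f < +oo)%E -> (wsq g < +oo)%E -> (wsq h < +oo)%E ->
  wdot (fun i => f i + g i) h = wdot f h + wdot g h.
Proof.
move=> ff fg fh; rewrite -usumD; [|exact: wdot_summable|exact: wdot_summable].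
by congr usum; apply/funext => i; ring.
Qed.

Lemma wdotNl f g : wdot (fun i => - f i) g = - wdot f g.
Proof. by rewrite -usumN; congr usum; apply/funext => i; ring. Qed.

Lemma wdotBl f g h : (wsq f < +oo)%E -> (wsq g < +oo)%E -> (wsq h < +oo)%E ->
  wdot (f \- g) h = wdot f h - wdot g h.
Proof. by move=> ff fg fh; rewrite wdotDl ?wdotNl ?wsqN. Qed.

Lemma wdotZr k f g : (wsq f < +oo)%E -> (wsq g < +oo)%E ->
  wdot f (fun i => k * g i) = k * wdot f g.
Proof. by move=> ff fg; rewrite wdotC wdotZl// wdotC. Qed.

Lemma wdotDr f g h : (wsq f < +oo)%E -> (wsq g < +oo)%E -> (wsq h < +oo)%E ->
  wdot h (fun i => f i + g i) = wdot h f + wdot h g.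
Proof. by move=> *; rewrite !(wdotC h) wdotDl. Qed.

Lemma wdotBr f g h : (wsq f < +oo)%E -> (wsq g < +oo)%E -> (wsq h < +oo)%E ->
  wdot h (f \- g) = wdot h f - wdot h g.
Proof. by move=> *; rewrite !(wdotC h) wdotBl. Qed.

Lemma wdotE f : (wsq f < +oo)%E -> (wdot f f)%:E = wsq f.
Proof.
move=> ff; have E : (fun i => c i * f i * f i) = (fun i => c i * f i ^+ 2).
  by apply/funext => i; ring.
by rewrite /wdot E ge0_usum_esum//; exact: wsq_term_ge0.
Qed.

Lemma wdot_sq_ge0 f : 0 <= wdot f f.
Proof. by apply: usum_ge0 => i; rewrite -mulrA mulr_ge0// -expr2 sqr_ge0. Qed.

Lemma wdot_cauchy_schwarz f g : (wsq f < +oo)%E -> (wsq g < +oo)%E ->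
  wdot f g ^+ 2 <= wdot f f * wdot g g.
Proof.
move=> ff fg; apply: quadratic_ge0_discr => [|t]; first exact: wdot_sq_ge0.
have ftg := wsqZ_lty t fg; have fftg := wsqD_lty ff ftg.
have := wdot_sq_ge0 (fun i => f i + t * g i).
rewrite wdotDl// !wdotDr// !wdotZl// !wdotZr// (wdotC g f).
by congr (0 <= _); ring.
Qed.

(** Summability of [p * q] comes from the pointwise identity, so [p] may have infinite norm. In the
    Caccioppoli estimate [p] is the gradient of a function whose energy is not yet known to be
    finite. *)
Lemma wdot_subE f g f' g' p q :
    (forall i, p i * q i = f i * g i - f' i * g' i) ->
    (wsq f < +oo)%E -> (wsq g < +oo)%E -> (wsq f' < +oo)%E -> (wsq g' < +oo)%E ->
  wdot p q = wdot f g - wdot f' g'.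
Proof.
move=> pq ff gf ff' gf'; have := abs_summableZ (- 1) (wdot_summable ff' gf').
rewrite (_ : (fun i => _ * _) = fun i => - (c i * f' i * g' i)); last first.
  by apply/funext => i; ring.
move=> s; rewrite /wdot -usumN -usumD//; last exact: wdot_summable.
by congr usum; apply/funext => i; rewrite -!mulrA pq; ring.
Qed.

Lemma wdot_ge0 f g : (forall i, 0 <= f i * g i) -> 0 <= wdot f g.
Proof. by move=> fg; apply: usum_ge0 => i; rewrite -mulrA mulr_ge0. Qed.

Lemma wdot_young f g : (wsq f < +oo)%E -> (wsq g < +oo)%E ->
  2 * wdot f g <= wdot f f + wdot g g.
Proof.
move=> ff fg; have := wdot_sq_ge0 (f \- g).
have ffg := wsqB_lty ff fg.
by rewrite (wdotBl ff fg ffg) !(wdotBr ff fg)// (wdotC g f); lra.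
Qed.

(** * Norm convergence along a filter *)

Section Limits.
Context {T : Type} {F : set_system T} {FF : Filter F}.
Implicit Types u v : T -> I -> R.

Definition wcvg (u : T -> I -> R) f := (fun r => wsq (u r \- f)%R) @ F --> 0%E.

Lemma wcvgD u v f g : wcvg u f -> wcvg v g ->
  wcvg (fun r i => u r i + v r i) (fun i => f i + g i).
Proof.
move=> uf vg; apply: (@cvge0_le _ _ _ _ _
  (fun r => wsq (u r \- f)%R + wsq (v r \- g)%R)%E 2).
- by move=> r; exact: wsq_ge0.
- by move=> r; rewrite adde_ge0// wsq_ge0.
- apply: nearW => r; rewrite muleDr ?ge0_adde_def ?inE ?wsq_ge0//.
  apply: le_trans (wsqD_le _ _); rewrite le_eqVlt; apply/orP; left; apply/eqP.
  by congr wsq; apply/funext => i /=; ring.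
- by apply: cvge0D => // r; exact: wsq_ge0.
Qed.

Lemma wcvgZ (k : T -> R) (l : R) u f : (wsq f < +oo)%E -> k @ F --> l -> wcvg u f ->
  wcvg (fun r i => k r * u r i) (fun i => l * f i).
Proof.
move=> ff kl uf.
have step : wcvg (fun r i => k r * (u r i - f i) + (k r - l) * f i)
    (fun i => 0 + 0).
  apply: wcvgD.
    apply: (@cvge0_le _ _ _ _ _ (fun r => wsq (u r \- f)%R) ((`|l| + 1) ^+ 2)) => //.
    - by move=> r; exact: wsq_ge0.
    - by move=> r; exact: wsq_ge0.
    near=> r; rewrite (_ : _ \- _ = fun i => k r * (u r \- f) i); last first.
      by apply/funext => i /=; ring.
    rewrite wsqZ lee_wpmul2r ?wsq_ge0// lee_fin -real_normK ?num_real//.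
    rewrite ler_sqr ?nnegrE ?addr_ge0//.
    have : `|l - k r| <= 1.
      by near: r; move/cvgrPdist_le: kl; apply.
    by have := ler_normB l (l - k r); rewrite subKr; lra.
  apply/cvge0P => [r|e e0]; first exact: wsq_ge0.
  have w0 := wdot_sq_ge0 f.
  (* The minimum with 1 bounds the square of [k r - l] by its absolute value. *)
  have d1 : 0 < Num.min 1 (e / (wdot f f + 1)).
    by rewrite lt_min ltr01 divr_gt0// ltr_wpDl.
  near=> r; rewrite (_ : _ \- _ = fun i => (k r - l) * f i); last first.
    by apply/funext => i /=; rewrite subr0.
  rewrite wsqZ -wdotE// -EFinM lee_fin -real_normK ?num_real//.
  have : `|k r - l| <= Num.min 1 (e / (wdot f f + 1)).
    by rewrite distrC; near: r; move/cvgrPdist_le: kl; apply.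
  rewrite le_min => /andP[le1]; rewrite ler_pdivlMr ?ltr_wpDl// => le2.
  apply: le_trans le2; rewrite expr2 -mulrA ler_wpM2l//.
  by apply: (le_trans (ler_wpM2r w0 le1)); rewrite mul1r lerDl.
by move: step; rewrite /wcvg; apply: cvg_trans; apply: near_eq_cvg;
  apply: nearW => r; congr wsq; apply/funext => i /=; ring.
Unshelve. all: by end_near. Qed.

Lemma wcvgN u f : wcvg u f -> wcvg (fun r i => - u r i) (fun i => - f i).
Proof.
apply: cvg_trans; apply: near_eq_cvg; apply: nearW => r.
by rewrite -wsqN; congr wsq; apply/funext => i /=; ring.
Qed.

Lemma wcvgB u v f g : wcvg u f -> wcvg v g ->
  wcvg (fun r i => u r i - v r i) (fun i => f i - g i).
Proof. by move=> uf /wcvgN; exact: wcvgD. Qed.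

Lemma wcvg_wsq_lty u f : (wsq f < +oo)%E -> wcvg u f ->
  \forall r \near F, (wsq (u r) < +oo)%E.
Proof.
move=> ff /(cvge0P (fun r => wsq_ge0 _)) /(_ 1 ltr01); apply: filterS => r ur.
have -> : u r = fun i => (u r \- f) i + f i by apply/funext => i /=; ring.
by apply: wsqD_lty => //; apply: le_lt_trans ur _; rewrite ltry.
Qed.

Lemma wdot_cvg u f g : (wsq f < +oo)%E -> (wsq g < +oo)%E -> wcvg u f ->
  (fun r => wdot (u r) g) @ F --> wdot f g.
Proof.
move=> ff fg uf; have w0 := wdot_sq_ge0 g.
apply/cvgrPdist_le => e e0.
have e1 : 0 < e ^+ 2 / (wdot g g + 1) by rewrite divr_gt0 ?exprn_gt0// ltr_wpDl.
have small := (cvge0P (fun r => wsq_ge0 (u r \- f))).1 uf _ e1.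
near=> r.
have ur : (wsq (u r) < +oo)%E by near: r; exact: wcvg_wsq_lty uf.
have urf := wsqB_lty ur ff.
rewrite distrC -wdotBl// -ler_sqr ?nnegrE ?(ltW e0)// real_normK ?num_real//.
apply: le_trans (wdot_cauchy_schwarz urf fg) _.
have : (wsq (u r \- f)%R <= (e ^+ 2 / (wdot g g + 1))%:E)%E by near: r; exact: small.
rewrite -wdotE// lee_fin ler_pdivlMr ?ltr_wpDl//; apply: le_trans.
by rewrite ler_wpM2l ?wdot_sq_ge0// lerDl.
Unshelve. all: by end_near. Qed.

Lemma wdot_cvgr u f g : (wsq f < +oo)%E -> (wsq g < +oo)%E -> wcvg u f ->
  (fun r => wdot g (u r)) @ F --> wdot g f.
Proof.
move=> ff fg uf; rewrite (_ : (fun r => _) = fun r => wdot (u r) g).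
  by rewrite wdotC; exact: wdot_cvg.
by apply/funext => r; rewrite wdotC.
Qed.

Lemma wdot_sq_cvg u f : (wsq f < +oo)%E -> wcvg u f ->
  (fun r => wdot (u r) (u r)) @ F --> wdot f f.
Proof.
move=> ff uf.
(* The identity behind this is [|u|^2 = |u - f|^2 + 2 <u, f> - |f|^2]. *)
have step : (fun r => fine (wsq (u r \- f)) + 2 * wdot (u r) f - wdot f f) @ F -->
    fine (0%:E : \bar R) + 2 * wdot f f - wdot f f.
  apply: cvgB; last exact: cvg_cst.
  by apply: cvgD; [exact: fine_cvg|apply: cvgMr; exact: wdot_cvg].
move: step; rewrite [in X in _ --> X -> _](_ : _ - _ = wdot f f); last first.
  by rewrite /=; ring.
apply: cvg_trans; apply: near_eq_cvg; have := wcvg_wsq_lty ff uf.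
apply: filterS => r ur; have urf := wsqB_lty ur ff.
rewrite -wdotE//= (wdotBl ur ff urf) !(wdotBr ur ff)// (wdotC f); ring.
Qed.

Lemma wcvg_cst f : wcvg (fun=> f) f.
Proof.
rewrite /wcvg (_ : (fun=> _) = fun=> 0%E); first exact: cvg_cst.
by apply/funext => r; apply: esum1 => i _ /=; rewrite subrr expr0n mulr0.
Qed.

Lemma wcvg_le u v f g : (\forall r \near F, forall i, `|v r i - g i| <= `|u r i - f i|) ->
  wcvg u f -> wcvg v g.
Proof.
move=> vu; apply: (@cvge0_le _ _ _ _ _ _ 1).
- by move=> r; exact: wsq_ge0.
- by move=> r; exact: wsq_ge0.
- by apply: filterS vu => r vu; rewrite mul1e; exact: wsq_le.
Qed.

Lemma near_eq_wcvg u v f : (\forall r \near F, v r = u r) -> wcvg u f -> wcvg v f.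
Proof. by move=> vu; apply: wcvg_le; apply: filterS vu => r ->. Qed.

Lemma wcvg_at u f i : 0 < c i -> wcvg u f -> (fun r => u r i) @ F --> f i.
Proof.
move=> ci uf; apply/cvgrPdist_le => e e0.
have e1 : 0 < c i * e ^+ 2 by rewrite mulr_gt0 ?exprn_gt0.
have small := (cvge0P (fun r => wsq_ge0 (u r \- f))).1 uf _ e1.
near=> r; rewrite distrC -ler_sqr ?nnegrE ?(ltW e0)// real_normK ?num_real//.
rewrite -(ler_pM2l ci) -lee_fin.
apply: le_trans (_ : (wsq (u r \- f)%R <= _)%E); last by near: r; exact: small.
apply: esum_ge; exists [set i]; first by split.
by rewrite fsbig_set1.
Unshelve. all: by end_near. Qed.

End Limits.

End WeightedL2.

(** * Fatou's lemma and dominated convergence *)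

Section WeightedL2Limits.
Context {R : realType} {I : choiceType} (c : I -> R).
Hypothesis c_ge0 : forall i, 0 <= c i.

Let cvg_finite_sum (X : {fset I}) (u : nat -> I -> R) (l : I -> R) :
    (forall i, u n i @[n --> \oo] --> l i) ->
  (\sum_(i <- X) c i * u n i ^+ 2) @[n --> \oo] --> \sum_(i <- X) c i * l i ^+ 2.
Proof.
move=> ul; apply: cvg_big => [|i _]; first exact: add_continuous.
by apply: cvgMr; apply: cvgM; exact: ul.
Qed.

(** [wsq] is a supremum of finite partial sums, and each of these passes to the pointwise limit. *)
Lemma wsq_fatou (u : nat -> I -> R) (l : I -> R) (b : \bar R) :
    (forall i, u n i @[n --> \oo] --> l i) -> (forall n, wsq c (u n) <= b)%E ->
  (wsq c l <= b)%E.
Proof.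
move=> ul; case: b => [b|_|]; last 2 first.
- exact: leey.
- by move=> /(_ 0%N) ub; have := le_trans (wsq_ge0 c_ge0 (u 0%N)) ub.
move=> ub; apply: ge_ereal_sup => _ [X [finX _] <-].
rewrite fsbig_finite//= sumEFin lee_fin.
apply: (cvgr_to_le (cvg_finite_sum ul)).
apply: nearW => n; rewrite -lee_fin -sumEFin -fsbig_finite//.
by apply: le_trans (ub n); apply: esum_ge; exists X.
Qed.

(** Outside a suitable finite set the sum is small uniformly in [n] because [|b| <= 1]; on the
    finite set pointwise convergence is enough. *)
Lemma wsq_dominated (b : nat -> I -> R) (f : I -> R) :
    (wsq c f < +oo)%E -> (forall n i, `|b n i| <= 1) ->
    (forall i, b n i @[n --> \oo] --> (0 : R)) ->
  (fun n => wsq c (fun i => b n i * f i)%R) @ \oo --> 0%E.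
Proof.
move=> ff b1 b0; apply/(cvge0P (fun n => wsq_ge0 c_ge0 _)) => e e0.
have e2 : 0 < e / 2 by rewrite divr_gt0.
have : (wsq c f - (e / 2)%:E < wsq c f)%E.
  by rewrite lteBlDr// lteDl// ?lte_fin// ge0_fin_numE ?wsq_ge0.
rewrite {2}/wsq => /ereal_sup_gt[_ [X [finX _] <-]] X_large.
have tail : (\esum_(i in ~` X) (c i * f i ^+ 2)%:E <= (e / 2)%:E)%E.
  have := ff; have := X_large; rewrite /wsq (esumID X setT); last first.
    by move=> i _; rewrite lee_fin mulr_ge0 ?sqr_ge0.
  rewrite !setTI -esum_fset//; last by move=> i _; rewrite lee_fin mulr_ge0 ?sqr_ge0.
  have := @esum_ge0 _ _ X (fun i => (c i * f i ^+ 2)%:E)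
    (fun i _ => wsq_term_ge0 c_ge0 f i).
  have := @esum_ge0 _ _ (~` X) (fun i => (c i * f i ^+ 2)%:E)
    (fun i _ => wsq_term_ge0 c_ge0 f i).
  case: esum => [t| |]//; case: esum => [s| |]//.
  by rewrite !lee_fin -EFinD -EFinB lte_fin => *; lra.
have fin_small : \forall n \near \oo,
    \sum_(i <- fset_set X) c i * (b n i * f i) ^+ 2 <= e / 2.
  have : (\sum_(i <- fset_set X) c i * (b n i * f i) ^+ 2) @[n --> \oo] -->
      \sum_(i <- fset_set X) c i * (0 * f i) ^+ 2.
    by apply: cvg_finite_sum => i; apply: cvgMl; exact: b0.
  rewrite big1 => [|i _]; last by rewrite mul0r expr0n mulr0.
  by move=> /cvgr_le; exact.
near=> n; rewrite /wsq (esumID X setT); last first.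
  by move=> i _; rewrite lee_fin mulr_ge0 ?sqr_ge0.
rewrite !setTI [e]splitr EFinD leeD//; last first.
  apply: le_trans tail; apply: le_esum => i _; rewrite lee_fin ler_wpM2l//.
  rewrite exprMn -[leRHS]mul1r ler_wpM2r ?sqr_ge0//.
  by rewrite -real_normK ?num_real// expr_le1.
rewrite esum_fset//; last by move=> i _; rewrite lee_fin mulr_ge0 ?sqr_ge0.
by rewrite fsbig_finite//= sumEFin lee_fin; near: n.
Unshelve. all: by end_near. Qed.

End WeightedL2Limits.

(** * Calculus on a weighted graph *)

Section GraphCalculus.
Context {R : realType} {G : weightedGraph R}.
Implicit Types f g h : G -> R.

Definition nbrs (x : G) : {fset G} := fset_set [set y | edge x y].

Lemma in_nbrs (x y : G) : (y \in nbrs x) = edge x y.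
Proof.
rewrite in_fset_set; last exact: edge_locally_finite.
by apply/idP/idP => [/set_mem|xy]; [|exact/mem_set].
Qed.

Lemma mu_notin_nbrs (x y : G) (X : {fset G}) :
  {subset nbrs x <= X} -> y \notin X -> mu x y = 0.
Proof. by move=> sX yX; apply: mu_eq0; rewrite -in_nbrs; apply: contra yX => /sX. Qed.

Lemma mu_ge0 (x y : G) : 0 <= mu x y.
Proof. by have [/mu_gt0/ltW|/mu_eq0->] := boolP (edge x y). Qed.

Lemma m_neq0 (x : G) : m x != 0. Proof. by rewrite gt_eqF ?m_gt0. Qed.

Lemma m_ge0 (x : G) : 0 <= m x. Proof. by rewrite ltW ?m_gt0. Qed.

Lemma laplacianE (X : {fset G}) f x : {subset nbrs x <= X} ->
  laplacian f x = (m x)^-1 * \sum_(y <- X) mu x y * (f y - f x).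
Proof.
move=> sX; rewrite /laplacian (fsbigTE X)// => y yX.
by rewrite (mu_notin_nbrs sX yX) mul0r.
Qed.

Lemma GammaE (X : {fset G}) f g x : {subset nbrs x <= X} ->
  Gamma f g x = (2 * m x)^-1 * \sum_(y <- X) mu x y * (f y - f x) * (g y - g x).
Proof.
move=> sX; rewrite /Gamma !(laplacianE _ sX) invfM -!mulrA; congr (_ * _).
rewrite !(mulrCA _ (m x)^-1) -!mulrBr; congr (_ * _).
rewrite !mulr_sumr -!sumrB; apply: eq_bigr => y _ /=; ring.
Qed.

Lemma laplacian_local f g x : f x = g x -> (forall y, edge x y -> f y = g y) ->
  laplacian f x = laplacian g x.
Proof.
move=> fgx fg; rewrite !(@laplacianE (nbrs x))//; congr (_ * _).
by rewrite !big_seq; apply: eq_bigr => y; rewrite in_nbrs => /fg ->; rewrite fgx.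
Qed.

Lemma Gamma_local f g f' g' x : f x = f' x -> g x = g' x ->
    (forall y, edge x y -> f y = f' y) -> (forall y, edge x y -> g y = g' y) ->
  Gamma f g x = Gamma f' g' x.
Proof.
move=> fx gx ff gg; rewrite !(@GammaE (nbrs x))//; congr (_ * _).
rewrite !big_seq; apply: eq_bigr => y; rewrite in_nbrs => xy.
by rewrite ff// gg// fx gx.
Qed.

Lemma GammaC f g : Gamma f g = Gamma g f.
Proof.
apply/funext => x; rewrite !(@GammaE (nbrs x))//; congr (_ * _).
by apply: eq_bigr => y _; rewrite mulrAC.
Qed.

Lemma GammaDl f g h x : Gamma (fun y => f y + g y) h x = Gamma f h x + Gamma g h x.
Proof.
rewrite !(@GammaE (nbrs x))// -mulrDr -big_split/=; congr (_ * _).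
by apply: eq_bigr => y _; ring.
Qed.

Lemma GammaZl k f h x : Gamma (fun y => k * f y) h x = k * Gamma f h x.
Proof.
rewrite !(@GammaE (nbrs x))// [RHS]mulrCA [X in _ = _ * X]mulr_sumr; congr (_ * _).
by apply: eq_bigr => y _; ring.
Qed.

Lemma GammaDr f g h x : Gamma h (fun y => f y + g y) x = Gamma h f x + Gamma h g x.
Proof. by rewrite !(GammaC h) GammaDl. Qed.

Lemma GammaZr k f h x : Gamma h (fun y => k * f y) x = k * Gamma h f x.
Proof. by rewrite !(GammaC h) GammaZl. Qed.

Lemma Gamma_sq_le f g x :
    (forall y, edge x y -> `|f y - f x| <= `|g y - g x|) ->
  Gamma f f x <= Gamma g g x.
Proof.
move=> fg; rewrite !(@GammaE (nbrs x))// ler_wpM2l ?invr_ge0 ?mulr_ge0 ?m_ge0//.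
rewrite !big_seq; apply: ler_sum => y; rewrite in_nbrs => /fg.
rewrite -!mulrA -!expr2 => h; rewrite ler_wpM2l ?mu_ge0//.
by rewrite -real_normK ?num_real// -[leRHS]real_normK ?num_real// ler_sqr ?nnegrE.
Qed.

Lemma Gamma_ge0 f x : 0 <= Gamma f f x.
Proof.
rewrite (@GammaE (nbrs x))// mulr_ge0 ?invr_ge0 ?mulr_ge0 ?m_ge0//.
by apply: sumr_ge0 => y _; rewrite -mulrA mulr_ge0 ?mu_ge0// -expr2 sqr_ge0.
Qed.

Lemma Gamma_cauchy_schwarz f g x : Gamma f g x ^+ 2 <= Gamma f f x * Gamma g g x.
Proof.
apply: quadratic_ge0_discr => [|t]; first exact: Gamma_ge0.
have := Gamma_ge0 (fun y => f y + t * g y) x.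
rewrite GammaDl !GammaDr !GammaZl !GammaZr (GammaC g f).
by congr (0 <= _); ring.
Qed.

Lemma C0P f : C0 f <-> exists X : {fset G}, forall x, x \notin X -> f x = 0.
Proof.
split=> [finf|[X fX]].
  exists (fset_set [set x | f x != 0]) => x; rewrite in_fset_set// notin_setE /=.
  by move=> /negP; rewrite negbK => /eqP.
apply: (@sub_finite_set _ _ [set` X]) => // x /=.
by apply: contraNT => /fX ->.
Qed.

Lemma C0_laplacian f : C0 f -> C0 (laplacian f).
Proof.
move=> /C0P[X fX]; apply/C0P.
exists (X `|` \bigcup_(x <- X) nbrs x)%fset => x.
rewrite in_fsetU negb_or => /andP[xX xN].
rewrite (@laplacianE (nbrs x))// big_seq big1 ?mulr0// => y.
rewrite in_nbrs => xy; rewrite (fX x)// (fX y) ?subrr ?mulr0//.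
apply: contra xN => yX; apply/bigfcupP; exists y; first by rewrite yX.
by rewrite in_nbrs edge_sym.
Qed.

Lemma C0_mull f g : C0 f -> C0 (fun x => f x * g x).
Proof. by move=> /C0P[X fX]; apply/C0P; exists X => x /fX ->; rewrite mul0r. Qed.

Lemma C0_Gamma f : C0 f -> C0 (Gamma f f).
Proof.
move=> f0; have /C0P[X fX] := f0; have /C0P[Y fY] := C0_laplacian f0.
have /C0P[Z fZ] := C0_laplacian (C0_mull f f0).
apply/C0P; exists (X `|` Y `|` Z)%fset => x.
rewrite !in_fsetU !negb_or => /andP[/andP[xX xY] xZ].
by rewrite /Gamma (fY x)// (fX x)// (fZ x)//; ring.
Qed.

(** * Edge gradients, energy and Green's formula *)

Definition grad f (p : G * G) : R := f p.2 - f p.1.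
Definition mu2 (p : G * G) : R := mu p.1 p.2.

Lemma mu2_ge0 p : 0 <= mu2 p. Proof. exact: mu_ge0. Qed.

Lemma energyE f : energy f = ((2^-1)%:E * wsq mu2 (grad f))%E.
Proof. by []. Qed.

Lemma QE f g : Q f g = 2^-1 * wdot mu2 (grad f) (grad g).
Proof. by []. Qed.

Lemma l2E f : l2 f = (wsq m f < +oo)%E. Proof. by []. Qed.

Lemma energy_ge0 f : (0 <= energy f)%E.
Proof. by rewrite energyE mule_ge0// wsq_ge0//; exact: mu2_ge0. Qed.

Lemma energy_lty f : (energy f < +oo)%E <-> (wsq mu2 (grad f) < +oo)%E.
Proof.
rewrite energyE; have := wsq_ge0 mu2_ge0 (grad f).
case: wsq => [r _|_|//]; first by rewrite -EFinM !ltry.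
by rewrite gt0_muley ?lte_fin ?invr_gt0.
Qed.

Lemma esum_edges (a : G -> G -> R) : (forall x y, 0 <= a x y) ->
    (forall x y, ~~ edge x y -> a x y = 0) ->
  (\esum_(p in [set: G * G]) (a p.1 p.2)%:E =
   \esum_(x in [set: G]) (\sum_(y <- nbrs x) a x y)%:E)%E.
Proof.
move=> a0 aE; have -> : [set: G * G] = [set: G] `*`` (fun=> [set: G]).
  by apply/seteqP; split.
rewrite -(@esum_esum _ _ _ _ _ (fun x y => (a x y)%:E)); last first.
  by move=> x y _ _; rewrite lee_fin.
apply: eq_esum => x _; rewrite (@esum_finite_support _ _ (a x) (nbrs x))//.
by move=> y; rewrite in_nbrs => /aE.
Qed.

Lemma wsq_grad_fst f g :
  wsq mu2 (fun p => f p.1 * grad g p)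
  = (\esum_(x in [set: G]) (2 * m x * f x ^+ 2 * Gamma g g x)%:E)%E.
Proof.
rewrite /wsq (esum_edges (a := fun x y => mu x y * (f x * (g y - g x)) ^+ 2)).
- apply: eq_esum => x _; congr EFin.
  rewrite (@GammaE (nbrs x))// (_ : 2 * m x * _ * _ =
    f x ^+ 2 * \sum_(y <- nbrs x) mu x y * (g y - g x) * (g y - g x)).
    by rewrite mulr_sumr; apply: eq_bigr => y _; ring.
  by field; rewrite m_neq0.
- by move=> x y; rewrite mulr_ge0 ?mu_ge0 ?sqr_ge0.
- by move=> x y /mu_eq0 ->; rewrite mul0r.
Qed.

(** For a cutoff [g] this bounds the error term [f * grad g] of the product rule by the [l2] norm of
    [f] alone. *)
Lemma wsq_grad_fst_le f g b : (forall x, Gamma g g x <= b) ->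
  (wsq mu2 (fun p => f p.1 * grad g p)%R <= (2 * b)%:E * l2_normsq f)%E.
Proof.
move=> gb; rewrite wsq_grad_fst.
(* A negative bound on [Gamma g g] can only occur on the empty graph. *)
have [b0|b0] := leP 0 b; last first.
  have no_vertex (x : G) : False.
    by have := le_lt_trans (le_trans (Gamma_ge0 g x) (gb x)) b0; rewrite ltxx.
  by rewrite /l2_normsq !esum1 ?mule0// => x _; case: (no_vertex x).
rewrite /l2_normsq -esumZ ?mulr_ge0//; last first.
  by move=> x; rewrite mulr_ge0 ?m_ge0 ?sqr_ge0.
apply: le_esum => x _; rewrite lee_fin.
rewrite (_ : 2 * m x * _ * _ = (2 * (m x * f x ^+ 2)) * Gamma g g x); last by ring.
rewrite (_ : 2 * b * _ = (2 * (m x * f x ^+ 2)) * b); last by ring.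
by rewrite ler_wpM2l// mulr_ge0// mulr_ge0 ?m_ge0 ?sqr_ge0.
Qed.

Lemma wsq_grad_snd f g :
  wsq mu2 (fun p => f p.2 * grad g p) = wsq mu2 (fun p => f p.1 * grad g p).
Proof.
rewrite /wsq (@reindex_esum _ _ _ setT setT (fun p : G * G => (p.2, p.1))).
  apply: eq_esum => -[x y] _; rewrite /mu2 /grad /= mu_sym; congr EFin; ring.
split=> //; first by move=> [x y] [x' y'] _ _ [-> ->].
by move=> [x y] _; exists (y, x).
Qed.

Lemma esum_m_Gamma f : (\esum_(x in [set: G]) (m x * Gamma f f x)%:E = energy f)%E.
Proof.
have := wsq_grad_fst (fun=> 1) f.
rewrite energyE (_ : (fun p => _ * grad f p) = grad f) => [->|]; last first.
  by apply/funext => p; rewrite mul1r.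
rewrite -esumZ//; last first.
  by move=> x; rewrite mulr_ge0 ?Gamma_ge0// mulr_ge0 ?sqr_ge0// mulr_ge0// m_ge0.
by apply: eq_esum => x _; congr EFin; field.
Qed.

Lemma m_Gamma_le_energy f x : ((m x * Gamma f f x)%:E <= energy f)%E.
Proof.
rewrite -esum_m_Gamma; apply: esum_ge; exists [set x]; first by split.
by rewrite fsbig_set1.
Qed.

(** This is where non-degeneracy of [m] enters. A single term of the energy sum gives
    [m x * Gamma f f x <= e], so by Cauchy-Schwarz [m * Gamma(f,g)^2 <= e * Gamma g g <= (e / m0) *
    m * Gamma g g]. *)
Lemma l2_normsq_Gamma_le (m0 : R) f g (e : R) : 0 < m0 -> (forall x : G, m0 <= m x) ->
    (energy f <= e%:E)%E ->
  (l2_normsq (Gamma f g) <= (e / m0)%:E * energy g)%E.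
Proof.
move=> m0_gt0 m_ge fe; have e0 : 0 <= e by rewrite -lee_fin (le_trans _ fe)// energy_ge0.
rewrite -esum_m_Gamma -esumZ ?divr_ge0 ?(ltW m0_gt0)//; last first.
  by move=> x; rewrite mulr_ge0 ?m_ge0 ?Gamma_ge0.
apply: le_esum => x _; rewrite lee_fin.
have mf : m x * Gamma f f x <= e by rewrite -lee_fin (le_trans (m_Gamma_le_energy f x)).
apply: le_trans (ler_wpM2l (m_ge0 x) (Gamma_cauchy_schwarz f g x)) _.
rewrite mulrA; apply: (le_trans (ler_wpM2r (Gamma_ge0 g x) mf)).
rewrite -mulrA ler_wpM2l// mulrA ler_peMl ?Gamma_ge0//.
by rewrite mulrC ler_pdivlMr// mul1r.
Qed.

Lemma l2_C0 f : C0 f -> l2 f.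
Proof.
move=> /C0P[X fX]; rewrite /l2 /l2_normsq (@esum_finite_support _ _ _ X) ?ltry//.
  by move=> x; rewrite mulr_ge0 ?m_ge0 ?sqr_ge0.
by move=> x /fX ->; rewrite expr0n mulr0.
Qed.

Lemma energy_C0 f : C0 f -> (energy f < +oo)%E.
Proof.
move=> f0; rewrite -esum_m_Gamma; have /C0P[X fX] := C0_Gamma f0.
rewrite (@esum_finite_support _ _ _ X) ?ltry//.
  by move=> x; rewrite mulr_ge0 ?m_ge0 ?Gamma_ge0.
by move=> x /fX ->; rewrite mulr0.
Qed.

Lemma green f g : C0 g -> Q f g = - l2_dot (laplacian f) g.
Proof.
(* Every edge with an endpoint in the support of [g] lies in [Y * Y], so both sides become finite
   sums although [f] is arbitrary. *)
move=> /C0P[X gX]; pose Y := (X `|` \bigcup_(x <- X) nbrs x)%fset.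
have XY x : x \in X -> x \in Y by move=> xX; rewrite in_fsetU xX.
have NY x : x \in X -> {subset nbrs x <= Y}.
  move=> xX y yx; rewrite in_fsetU; apply/orP; right; apply/bigfcupP.
  by exists x; rewrite ?xX.
pose YY := [fset p in [seq (x, y) | x <- Y, y <- Y]]%fset.
have sumYY (F : G -> G -> R) :
    \sum_(p <- YY) F p.1 p.2 = \sum_(x <- Y) \sum_(y <- Y) F x y.
  rewrite -(@big_allpairs _ _ _ _ _ _ _ (fun p => F p.1 p.2)).
  apply: perm_big; apply: uniq_perm => [||p]; first exact: fset_uniq.
    by apply: allpairs_uniq => // -[? ?] [? ?].
  by rewrite /YY in_fset.
rewrite /Q /l2_dot (@usum_finite_support _ _ _ X); last first.
  by move=> x /gX ->; rewrite mulr0.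
rewrite (@usum_finite_support _ _ _ YY); last first.
  move=> [x y] /= xyYY; have [xX|/gX gx0] := boolP (x \in X).
    have [yY|yY] := boolP (y \in Y); last by rewrite (mu_notin_nbrs (NY x xX) yY); ring.
    by move: xyYY; rewrite in_fset (allpairs_f pair (XY _ xX) yY).
  have [yX|/gX gy0] := boolP (y \in X); last by rewrite gx0 gy0; ring.
  have [xY|xY] := boolP (x \in Y).
    by move: xyYY; rewrite in_fset (allpairs_f pair xY (XY _ yX)).
  by rewrite mu_sym (mu_notin_nbrs (NY y yX) xY); ring.
rewrite (sumYY (fun x y => mu x y * (f y - f x) * (g y - g x))).
pose S := \sum_(x <- Y) \sum_(y <- Y) mu x y * (f y - f x) * g x.
(* Exchanging [x] and [y] turns the half with [g y] into [- S]; the factor [2^-1] of [Q] then leaves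
   one copy. *)
have -> : \sum_(x <- Y) \sum_(y <- Y) mu x y * (f y - f x) * (g y - g x) = - S - S.
  transitivity (\sum_(x <- Y) \sum_(y <- Y) mu x y * (f y - f x) * g y - S).
    rewrite -sumrB; apply: eq_bigr => x _; rewrite -sumrB.
    by apply: eq_bigr => y _; ring.
  congr (_ - _); rewrite exchange_big /= -sumrN; apply: eq_bigr => y _.
  by rewrite -sumrN; apply: eq_bigr => x _; rewrite mu_sym; ring.
rewrite (_ : - S - S = - (2 * S)); last by ring.
rewrite mulrN mulKf ?pnatr_eq0//; congr (- _).
rewrite /S (big_fsetID _ [pred x | x \in X] Y) /= [X in _ + X]big1_fset ?addr0; last first.
  move=> x; rewrite !inE /= => /andP[_ /gX ->] _.
  by rewrite big1// => y _; rewrite mulr0.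
have -> : [fset x in Y | x \in X]%fset = X.
  apply/fsetP => x; rewrite in_fset /= inE /= andbC.
  by have [/XY ->|] := boolP (x \in X).
rewrite !big_seq; apply: eq_bigr => x xX.
by rewrite (@laplacianE Y) ?mulVKf ?m_neq0 ?mulr_suml//; exact: NY.
Qed.

End GraphCalculus.

(** * Complete graphs *)

Lemma nondegenerate_measureP (R : realType) (G : weightedGraph R) :
  nondegenerate_measure G -> exists2 m0 : R, 0 < m0 & forall x : G, m0 <= m x.
Proof.
rewrite /nondegenerate_measure => inf_gt0.
have inf_le (x : G) : (ereal_inf (range (fun x : G => (m x)%:E)) <= (m x)%:E)%E.
  by apply: ereal_inf_lbound; exists x.
move: inf_gt0 inf_le; case: ereal_inf => [r| |]//.
  by rewrite lte_fin => r0 rm; exists r => // x; rewrite -lee_fin.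
(* The infimum is [+oo] only when there is no vertex. *)
by move=> _ no_vertex; exists 1 => // x; have := no_vertex x; rewrite leye_eq.
Qed.

(** * Negative parts *)

Section NegativePart.
Context {R : realType} {G : weightedGraph R}.
Implicit Types f g : G -> R.

Definition negpart f (x : G) : R := Num.max (- f x) 0.

Lemma negpart_ge0 f x : 0 <= negpart f x.
Proof. by rewrite /negpart le_max lexx orbT. Qed.

Lemma negpart_sqE f x : negpart f x * negpart f x = - (f x * negpart f x).
Proof. by rewrite /negpart; case: leP => _; ring. Qed.

Lemma negpart_norm_le f x : `|negpart f x| <= `|f x|.
Proof.
rewrite ger0_norm ?negpart_ge0// /negpart ge_max normr_ge0 andbT.
by rewrite -normrN ler_norm.
Qed.

Lemma l2_negpart f : l2 f -> l2 (negpart f).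
Proof.
move=> fl2; apply: le_lt_trans fl2; apply: (wsq_le (@m_ge0 _ G)).
exact: negpart_norm_le.
Qed.

(** Two functions and two vertices at once: equal functions give the gradient bound, equal vertices
    the continuity of [negpart] in [l2]. *)
Lemma negpart_dist_le f g x y : `|negpart f x - negpart g y| <= `|f x - g y|.
Proof.
rewrite /negpart.
by case: (leP (- f x)) => hf; case: (leP (- g y)) => hg;
  rewrite ler_norml; case: (ger0P (f x - g y)) => h; apply/andP; split; lra.
Qed.

Lemma negpart_grad_norm_le f p : `|grad (negpart f) p| <= `|grad f p|.
Proof. exact: negpart_dist_le. Qed.

Lemma negpart_grad_le0 f p : grad f p * grad (negpart f) p <= 0.
Proof.
rewrite /grad /negpart; have sq := sqr_ge0 (f p.2 - f p.1).
by case: (leP (- f p.2)) => h2; case: (leP (- f p.1)) => h1; nra.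
Qed.

(** Termwise, because [a] decreases when [a^-] increases. *)
Lemma Q_negpart_le0 f : Q f (negpart f) <= 0.
Proof.
rewrite QE pmulr_rle0 ?invr_gt0// -oppr_ge0 -wdotNl.
apply: wdot_ge0 => [|p]; first exact: mu2_ge0.
by rewrite mulNr oppr_ge0; exact: negpart_grad_le0.
Qed.

End NegativePart.

Section CompleteGraphs.
Context {R : realType} {G : weightedGraph R}.
Implicit Types f g h v w : G -> R.

Local Notation fin_energy f := (wsq mu2 (grad f) < +oo)%E.

Record cutoff (eta : nat -> G -> R) : Prop := Cutoff {
  cutoff_C0 : forall k, C0 (eta k);
  cutoff_ge0 : forall k x, 0 <= eta k x;
  cutoff_le1 : forall k x, eta k x <= 1;
  cutoff_cvg : forall x, eta k x @[k --> \oo] --> (1 : R);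
  cutoff_Gamma : forall k x, Gamma (eta k) (eta k) x <= k.+1%:R^-1 }.

Lemma complete_graph_cutoff : complete_graph G -> exists eta, cutoff eta.
Proof.
move=> [eta [eta_C0 eta_mono eta_cvg eta_Gamma]].
have eta_le1 k x : eta k x <= 1.
  have <- : limn (eta ^~ x) = 1 by apply/cvg_lim; [|exact: eta_cvg].
  apply: nondecreasing_cvgn_le; first by apply/nondecreasing_seqP => n.
  by apply/cvg_ex; exists 1; exact: eta_cvg.
(* The given functions may take negative values; [negpart] of [- eta k] is the positive part of
   [eta k]. Truncation is 1-Lipschitz, so it does not increase [Gamma]. *)
exists (fun k => negpart (fun x => - eta k x)); split.
- move=> k; have /C0P[X etaX] := eta_C0 k; apply/C0P; exists X => x /etaX eta0.
  by rewrite /negpart eta0 !oppr0 maxxx.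
- by move=> k x; exact: negpart_ge0.
- by move=> k x; rewrite /negpart opprK ge_max eta_le1 ler01.
- move=> x; apply/cvgrPdist_le => e e0; have := eta_cvg x => /cvgrPdist_le /(_ e e0).
  apply: filterS => k; have h1 := eta_le1 k x; rewrite ger0_norm ?subr_ge0// => h.
  by rewrite /negpart opprK; case: (leP (eta k x) 0) => h0; rewrite ger0_norm; lra.
- move=> k x; apply: le_trans (eta_Gamma k x); apply: Gamma_sq_le => y _.
  apply: le_trans (negpart_grad_norm_le (fun x => - eta k x) (x, y)) _.
  by rewrite /grad /= -opprD normrN.
Qed.

(** * Cutoff approximation and weak inequalities *)

Section Cutoffs.
Variables (eta : nat -> G -> R) (etaP : cutoff eta).

Lemma cutoffB1_norm k x : `|eta k x - 1| <= 1.
Proof.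
have := cutoff_ge0 etaP k x; have := cutoff_le1 etaP k x => ? ?.
by rewrite ler0_norm; lra.
Qed.

Lemma cutoff_wcvg f : l2 f -> wcvg m (F := \oo) (fun k x => eta k x * f x) f.
Proof.
move=> fl2; have := wsq_dominated (@m_ge0 _ G) (b := fun k x => eta k x - 1) fl2.
move=> /(_ cutoffB1_norm) dominated; rewrite /wcvg.
rewrite (_ : (fun k => _) = fun k => wsq m (fun x => (eta k x - 1) * f x)); last first.
  by apply/funext => k; congr wsq; apply/funext => x /=; ring.
apply: dominated => x; rewrite -[X in _ --> X](subrr 1).
by apply: cvgB; [exact: cutoff_cvg etaP x|exact: cvg_cst].
Qed.

(** By the product rule the error is [(eta - 1) * grad f + f * grad eta]. The first term vanishes by
    dominated convergence, the second by the bound [1/(k+1)] on [Gamma eta]. *)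
Lemma cutoff_grad_wcvg f : l2 f -> fin_energy f ->
  wcvg mu2 (F := \oo) (fun k => grad (fun x => eta k x * f x)) (grad f).
Proof.
move=> fl2 fE; rewrite /wcvg.
have split_grad k : grad (fun x => eta k x * f x) \- grad f =
    fun p => (eta k p.2 - 1) * grad f p + f p.1 * grad (eta k) p.
  by apply/funext => p; rewrite /grad /=; ring.
apply: (@cvge0_le _ _ _ _ _ (fun k => wsq mu2 (fun p => (eta k p.2 - 1) * grad f p)%R +
    wsq mu2 (fun p => f p.1 * grad (eta k) p)%R)%E 2).
- by move=> k; exact: wsq_ge0 mu2_ge0 _.
- by move=> k; rewrite adde_ge0// wsq_ge0//; exact: mu2_ge0.
- apply: nearW => k; rewrite split_grad muleDr ?ge0_adde_def ?inE ?wsq_ge0//;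
    try exact: mu2_ge0.
  by apply: wsqD_le; exact: mu2_ge0.
apply: cvge0D; try by move=> k; exact: wsq_ge0 mu2_ge0 _.
  apply: (wsq_dominated mu2_ge0 fE (b := fun k p => eta k p.2 - 1)) => [k p|p].
    exact: cutoffB1_norm.
  rewrite -[X in _ --> X](subrr 1).
  by apply: cvgB; [exact: cutoff_cvg etaP p.2|exact: cvg_cst].
apply/(cvge0P (fun k => wsq_ge0 mu2_ge0 _)) => e e0.
have N0 : 0 <= wdot m f f by apply: wdot_sq_ge0; exact: m_ge0.
have N1 : 0 < 2 * (wdot m f f + 1) by rewrite mulr_gt0// ltr_wpDl.
have : \forall k \near \oo, k.+1%:R^-1 <= e / (2 * (wdot m f f + 1)).
  by apply: (cvgr_le _ (@cvg_harmonic R)); rewrite divr_gt0.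
apply: filterS => k; rewrite ler_pdivlMr// => k_small.
apply: (le_trans (wsq_grad_fst_le f (cutoff_Gamma etaP k))).
rewrite -[l2_normsq f]/(wsq m f) -wdotE//; last exact: m_ge0.
rewrite -EFinM lee_fin; apply: le_trans k_small.
rewrite (mulrC 2) -mulrA ler_wpM2l ?invr_ge0//.
by rewrite ler_wpM2l// lerDl.
Qed.

Lemma DQP f : DQ f <-> l2 f /\ fin_energy f.
Proof.
split=> [[phi phi_C0 phi_cvg]|[fl2 fE]].
  have Q_ge0 n : (0 <= Q_normsq (f \- phi n)%R)%E.
    by rewrite adde_ge0 ?energy_ge0// (wsq_ge0 (@m_ge0 _ G)).
  have [n] := filter_ex ((cvge0P Q_ge0).1 phi_cvg 1 ltr01).
  move=> /le_lt_trans/(_ (ltry _)) fphi.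
  have fE' : f = fun x => (f \- phi n) x + phi n x by apply/funext => x /=; ring.
  split.
    rewrite fE'; apply: (wsqD_lty (@m_ge0 _ G)); last exact: l2_C0.
    by apply: le_lt_trans fphi; rewrite leeDl// energy_ge0.
  rewrite (_ : grad f = fun p => grad (f \- phi n) p + grad (phi n) p); last first.
    by apply/funext => p; rewrite /grad /=; ring.
  apply: (wsqD_lty mu2_ge0); apply/energy_lty; last exact: energy_C0.
  by apply: le_lt_trans fphi; rewrite leeDr// (wsq_ge0 (@m_ge0 _ G)).
exists (fun k x => eta k x * f x) => [k|]; first exact/C0_mull/(cutoff_C0 etaP).
apply: cvge0D.
- by move=> k; exact: wsq_ge0 (@m_ge0 _ G) _.
- by move=> k; exact: energy_ge0.
- have := cutoff_wcvg fl2; apply: cvg_trans; apply: near_eq_cvg; apply: nearW => k.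
  exact: wsqB_sym.
- apply: (@cvge0_le _ _ _ _ _
    (fun k => wsq mu2 (grad (fun x => eta k x * f x) \- grad f)%R) 2^-1).
  + by move=> k; exact: energy_ge0.
  + by move=> k; exact: wsq_ge0 mu2_ge0 _.
  + apply: nearW => k; rewrite energyE [leRHS](_ : _ = (2^-1%:E * wsq mu2
      (grad f \- grad (fun x => eta k x * f x))%R)%E); last by congr (_ * _)%E; exact: wsqB_sym.
    rewrite (_ : grad (f \- _) = grad f \- grad (fun x => eta k x * f x))//.
    by apply/funext => p; rewrite /grad /=; ring.
  + exact: cutoff_grad_wcvg.
Qed.

Lemma DQ_negpart f : DQ f -> DQ (negpart f).
Proof.
move=> /DQP[fl2 fE]; apply/DQP; split; first exact: l2_negpart.
by apply: le_lt_trans fE; apply: (wsq_le mu2_ge0); exact: negpart_grad_norm_le.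
Qed.

Lemma l2_dot_le_C0 h g v : C0 v -> (forall x, 0 <= v x) ->
  (forall x, h x <= g x) -> l2_dot h v <= l2_dot g v.
Proof.
move=> /C0P[X vX] v0 hg; rewrite /l2_dot !(@usum_finite_support _ _ _ X).
- apply: ler_sum => x _; rewrite -!mulrA ler_wpM2l ?m_ge0//.
  by rewrite ler_wpM2r.
- by move=> x /vX ->; rewrite mulr0.
- by move=> x /vX ->; rewrite mulr0.
Qed.

(* Testing [h <= laplacian w] against [eta^2 w] bounds the energy of [eta w], since
   [(w y - w x) (eta^2 w y - eta^2 w x)
     = (eta w y - eta w x)^2 - w x w y (eta y - eta x)^2]. *)
Lemma caccioppoli w h : l2 w -> l2 h -> (forall x, 0 <= w x) ->
  (forall x, h x <= laplacian w x) -> fin_energy w.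
Proof.
move=> wl2 hl2 w0 hw.
(* Testing gives [2 Q(w, eta^2 w) <= - 2 <h, eta^2 w> <= |h|^2 + |w|^2], and the error term
   contributes at most [2 |w|^2] since [Gamma eta <= 1]. The bound does not depend on [k], so Fatou
   applies. *)
set b := wdot m h h + 3 * wdot m w w.
suff : (wsq mu2 (grad w) <= b%:E)%E by move=> /le_lt_trans; apply; rewrite ltry.
apply: (wsq_fatou mu2_ge0 (u := fun k => grad (fun x => eta k x * w x))) => [p|k].
  have lim x : (eta k x * w x) @[k --> \oo] --> w x.
    by rewrite -[X in _ --> X]mul1r; apply: cvgMl; exact: cutoff_cvg etaP x.
  by apply: cvgB; exact: lim.
have a_C0 := cutoff_C0 etaP k; have a0 := cutoff_ge0 etaP k.
have a1 := cutoff_le1 etaP k; have aG := cutoff_Gamma etaP k.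
set a := eta k in a_C0 a0 a1 aG *.
set g := fun x => a x * (a x * w x).
have g_C0 : C0 g by exact: C0_mull.
have g0 x : 0 <= g x by rewrite !mulr_ge0.
have gl2 : l2 g by exact: l2_C0.
have aw_E : fin_energy (fun x => a x * w x)%R by apply/energy_lty/energy_C0/C0_mull.
have A_le : (wsq mu2 (fun p => w p.1 * grad a p)%R <= 2%:E * wsq m w)%E.
  have := @wsq_grad_fst_le _ _ w a 1; rewrite mulr1; apply => x.
  by apply: (le_trans (aG x)); rewrite invf_le1// ler1n.
have A_lty : (wsq mu2 (fun p => w p.1 * grad a p)%R < +oo)%E.
  by apply: le_lt_trans A_le _; rewrite lte_mul_pinfty.
have B_lty : (wsq mu2 (fun p => w p.2 * grad a p)%R < +oo)%E by rewrite wsq_grad_snd.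
have AE := wdotE mu2_ge0 A_lty; have BE := wdotE mu2_ge0 B_lty.
have AB := wdot_young mu2_ge0 A_lty B_lty.
have {}BE : wdot mu2 (fun p => w p.2 * grad a p) (fun p => w p.2 * grad a p)
    = wdot mu2 (fun p => w p.1 * grad a p) (fun p => w p.1 * grad a p).
  by apply/EFin_inj; rewrite AE BE wsq_grad_snd.
have ww := wdotE (@m_ge0 _ G) wl2.
move: A_le; rewrite -AE -ww -EFinM lee_fin => A_le.
(* The energy of [w] is still unknown here; all gradients on the right have finite norm. *)
have Qwg : wdot mu2 (grad w) (grad g) =
    wdot mu2 (grad (fun x => a x * w x)) (grad (fun x => a x * w x))
    - wdot mu2 (fun p => w p.1 * grad a p) (fun p => w p.2 * grad a p).
  by apply: (wdot_subE mu2_ge0) => // p; rewrite /grad /g; ring.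
have test : Q w g <= - wdot m h g.
  by rewrite green// lerN2; exact: l2_dot_le_C0.
have hg := wdot_young (@m_ge0 _ G) (f := fun x => - h x) (g := g).
move: hg; rewrite wsqN => /(_ hl2 gl2).
rewrite !wdotNl (wdotC _ h (fun x => - h x)) wdotNl opprK => hg.
have gw : wdot m g g <= wdot m w w.
  rewrite -lee_fin !wdotE//; try exact: m_ge0.
  apply: (wsq_le (@m_ge0 _ G)) => x; rewrite !ger0_norm// /g.
  rewrite mulrA -[leRHS]mul1r ler_wpM2r// -[leRHS]mul1r.
  by apply: ler_pM.
rewrite -wdotE//; last exact: mu2_ge0.
rewrite lee_fin /b; move: test; rewrite QE Qwg; lra.
Qed.

Lemma green_DQ f v : C0 f -> DQ v -> Q f v = - l2_dot (laplacian f) v.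
Proof.
move=> f0 /DQP[vl2 vE]; have fE := energy_C0 f0; have Lfl2 := l2_C0 (C0_laplacian f0).
have lim_l : - wdot m (laplacian f) (fun x => eta k x * v x) @[k --> \oo] -->
    - wdot m (laplacian f) v.
  by apply: cvgN; exact: (wdot_cvgr (@m_ge0 _ G) vl2 Lfl2 (cutoff_wcvg vl2)).
have lim_r : Q f (fun x => eta k x * v x) @[k --> \oo] --> Q f v.
  rewrite QE; apply: cvgMr.
  by apply: (wdot_cvgr mu2_ge0 vE) (cutoff_grad_wcvg vl2 vE); apply/energy_lty.
apply: (cvg_unique _ lim_r) => //.
rewrite [X in X @ _](_ : _ = fun k => - wdot m (laplacian f) (fun x => eta k x * v x))//.
by apply/funext => k; rewrite green//; exact/C0_mull/(cutoff_C0 etaP).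
Qed.

(** [laplacian w] need not be in [l2], so Green's formula is applied to the finitely supported
    [eta k * v], and the finite energies of [w] and [v] carry the inequality to the limit. *)
Lemma weak_laplacian_ge w h v : l2 h -> DQ w ->
    (forall x, h x <= laplacian w x) -> DQ v -> (forall x, 0 <= v x) ->
  l2_dot h v <= - Q w v.
Proof.
move=> hl2 /DQP[_ wE] hw /DQP[vl2 vE] v0.
pose vk k x := eta k x * v x.
have lim_l : wdot m h (vk k) @[k --> \oo] --> wdot m h v.
  exact: (wdot_cvgr (@m_ge0 _ G) vl2 hl2 (cutoff_wcvg vl2)).
have lim_r : - Q w (vk k) @[k --> \oo] --> - Q w v.
  apply: cvgN; rewrite QE; apply: cvgMr.
  exact: (wdot_cvgr mu2_ge0 vE wE (cutoff_grad_wcvg vl2 vE)).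
apply: (ler_cvg_to lim_l lim_r); apply: nearW => k.
have vk_C0 : C0 (vk k) by exact/C0_mull/(cutoff_C0 etaP).
rewrite green// opprK; apply: l2_dot_le_C0 => // x.
by rewrite mulr_ge0 ?(cutoff_ge0 etaP).
Qed.

End Cutoffs.
End CompleteGraphs.

(** * The generator of the Dirichlet form *)

Section FormGenerator.
Context {R : realType} {G : weightedGraph R}.
Variables (eta : nat -> G -> R) (etaP : cutoff eta).
Variables (L : l2_operator G) (L_generator : form_generator L).
Implicit Types f g : G -> R.

Lemma l2_dotNl f g : l2_dot (fun x => - f x) g = - l2_dot f g.
Proof. exact: wdotNl. Qed.

Lemma l2_dotC f g : l2_dot f g = l2_dot g f.
Proof. exact: wdotC. Qed.

Lemma QC f g : Q f g = Q g f.
Proof. by rewrite QE wdotC. Qed.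

Definition delta (y z : G) : R := (z == y)%:R.

Lemma delta_C0 y : C0 (delta y).
Proof.
apply/C0P; exists [fset y]%fset => z; rewrite in_fset1 /delta => /negbTE ->.
by [].
Qed.

Lemma l2_dot_delta f y : l2_dot f (delta y) = m y * f y.
Proof.
rewrite /l2_dot (@usum_finite_support _ _ _ [fset y]%fset).
  by rewrite big_seq_fset1 /delta eqxx mulr1.
by move=> z; rewrite in_fset1 /delta => /negbTE ->; rewrite mulr0.
Qed.

Lemma C0_DQ f : C0 f -> DQ f.
Proof.
move=> f0; apply/(DQP etaP); split; first exact: l2_C0.
exact/energy_lty/energy_C0.
Qed.

Lemma generator_DQ f : dom L f -> DQ f.
Proof.
have [_ _ [S [[_ _ domE _] domS _]]] := L_generator.
by move=> /domE[Sf _]; rewrite -domS.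
Qed.

(** With [S] the square root of [- L], self-adjointness gives
    [<S (S f), g> = <S f, S g> = Q f g]. *)
Lemma generator_form f g : dom L f -> DQ g -> l2_dot (L f) g = - Q f g.
Proof.
move=> Lf DQg; have DQf := generator_DQ Lf.
have [_ _ [S [[[_ S_sa] _ domE SS] domS QS]]] := L_generator.
have /domE[Sf SSf] := Lf.
have Sg : dom S g by rewrite domS.
have [_ _ /(_ _ SSf) adj] := (S_sa g (S g)).2 (conj Sg erefl).
have -> : L f = (fun x => - S (S f) x) by apply/funext => x; rewrite SS// opprK.
by rewrite l2_dotNl; congr (- _); exact: etrans adj (esym (QS _ _ DQf DQg)).
Qed.

(** Green's formula reads [<S g, S f> = <g, - laplacian f>] for all [g] in [dom S]. Thus [S f] lies
    in the domain of the adjoint of [S], which is [S] itself. *)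
Lemma generator_C0 f : C0 f -> dom L f /\ L f = laplacian f.
Proof.
move=> f0; have DQf := C0_DQ f0.
have [_ _ [S [[[_ S_sa] _ domE SS] domS QS]]] := L_generator.
have Sf : dom S f by rewrite domS.
have [SSf SSE] : dom S (S f) /\ S (S f) = (fun x => - laplacian f x).
  apply/S_sa; split; first exact: app_l2.
    rewrite l2E wsqN; exact/l2_C0/C0_laplacian.
  move=> g Sg; have DQg : DQ g by rewrite -domS.
  apply: etrans (esym (QS _ _ DQg DQf)) _.
  by rewrite QC (green_DQ etaP f0 DQg) -l2_dotNl l2_dotC.
have Lf : dom L f by apply/domE.
split=> //; apply/funext => x; apply: oppr_inj; by rewrite -SS// SSE.
Qed.

(** Paired with a [delta], both sides equal [- Q f (delta x)]. *)
Lemma generator_laplacian f : dom L f -> L f = laplacian f.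
Proof.
move=> Lf; apply/funext => x; apply: (mulfI (m_neq0 x)).
rewrite -!l2_dot_delta generator_form//; last exact/C0_DQ/delta_C0.
by rewrite green ?opprK//; exact: delta_C0.
Qed.

(** Convergence of [f] and of [L f] in [l2] thereby implies convergence of the gradients. *)
Lemma generator_energy_le f : dom L f ->
  (wsq mu2 (grad f) <= wsq m f + wsq m (L f))%E.
Proof.
move=> Lf; have fl2 := dom_l2 Lf; have Lfl2 := app_l2 Lf.
have DQf := generator_DQ Lf; have /(DQP etaP)[_ fE] := DQf.
rewrite -(wdotE mu2_ge0 fE) -(wdotE (@m_ge0 _ G) fl2) -(wdotE (@m_ge0 _ G) Lfl2).
rewrite -EFinD lee_fin.
have := wdot_young (@m_ge0 _ G) (f := fun x => - L f x) (g := f).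
rewrite wsqN => /(_ Lfl2 fl2).
rewrite !wdotNl (wdotC _ (L f) (fun x => - L f x)) wdotNl opprK.
have form : wdot m (L f) f = - Q f f by exact: generator_form.
by rewrite form QE; lra.
Qed.

End FormGenerator.

(** * The semigroup *)

Section Semigroup.
Context {R : realType} {G : weightedGraph R}.
Variables (L : l2_operator G) (T : R -> (G -> R) -> G -> R).
Hypothesis T_semigroup : exp_semigroup L T.
Implicit Types (f g : G -> R) (s t : R).

Let c_ge0 := @m_ge0 _ G.

(** The constant depends on [t] with no uniformity near a given time, so left continuity does not
    follow directly from right continuity. *)
Lemma semigroup_bound t : 0 <= t -> exists2 C : R, 0 <= C &
  forall f, l2 f -> (l2_normsq (T t f) <= C%:E * l2_normsq f)%E.
Proof.
have [[bound _ _ _ _] _] := T_semigroup.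
move=> /bound[C TC]; exists `|C| => // f fl2; apply: le_trans (TC f fl2) _.
by rewrite lee_wpmul2r ?lee_fin ?ler_norm// (wsq_ge0 c_ge0).
Qed.

Lemma semigroup_l2 t f : 0 <= t -> l2 f -> l2 (T t f).
Proof.
move=> /semigroup_bound[C C0 TC] fl2; apply: le_lt_trans (TC f fl2) _.
by rewrite lte_mul_pinfty.
Qed.

Lemma semigroup0 f : l2 f -> T 0 f = f.
Proof. by have [[_ _ T0 _ _] _] := T_semigroup; exact: T0. Qed.

Lemma semigroup_linear t a f g : 0 <= t -> l2 f -> l2 g ->
  T t (fun x => a * f x + g x) = (fun x => a * T t f x + T t g x).
Proof. by have [[_ Tlin _ _ _] _] := T_semigroup => t0; exact: Tlin. Qed.

Lemma semigroupB t f g : 0 <= t -> l2 f -> l2 g -> T t (f \- g) = T t f \- T t g.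
Proof.
move=> t0 fl2 gl2; rewrite (_ : f \- g = fun x => - 1 * g x + f x).
  by rewrite semigroup_linear//; apply/funext => x /=; ring.
by apply/funext => x /=; ring.
Qed.

Lemma semigroup_zero t : 0 <= t -> T t (fun=> 0) = (fun=> 0).
Proof.
move=> t0; have z2 : l2 (fun _ : G => 0 : R).
  by apply: l2_C0; apply/C0P; exists fset0.
have := semigroup_linear (- 1) t0 z2 z2.
rewrite (_ : (fun x => _) = fun=> 0); last by apply/funext => x; ring.
by move=> ->; apply/funext => x; ring.
Qed.

Lemma semigroupD s t f : 0 <= s -> 0 <= t -> l2 f -> T (s + t) f = T s (T t f).
Proof. by have [[_ _ _ TD _] _] := T_semigroup => s0 t0; exact: TD. Qed.

Lemma semigroup_wcvg {I : Type} {F : set_system I} {FF : Filter F}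
    (u : I -> G -> R) f t : 0 <= t -> l2 f -> (forall i, l2 (u i)) ->
  wcvg m (F := F) u f -> wcvg m (F := F) (fun i => T t (u i)) (T t f).
Proof.
move=> t0 fl2 ul2; have [C C0 TC] := semigroup_bound t0.
apply: (@cvge0_le _ _ _ _ _ _ C).
- by move=> i; exact: wsq_ge0.
- by move=> i; exact: wsq_ge0.
- apply: nearW => i; rewrite -semigroupB//; apply: TC.
  by apply: wsqB_lty; [exact: c_ge0|exact: ul2|exact: fl2].
Qed.

Definition quotient (h : R) (f g : G -> R) (x : G) : R := h^-1 * (f x - g x).

Lemma generator_rderiv f : dom L f ->
  wcvg m (F := 0^'+) (fun h => quotient h (T h f) f) (L f).
Proof.
by move=> Lf; have [_ /(_ f (L f) (dom_l2 Lf) (app_l2 Lf))[_]] := T_semigroup; apply.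
Qed.

(** The difference quotient of [T s f] is [T s] applied to that of [f], and [T s] is bounded; the
    exact description of the generator yields both domain and value. *)
Lemma semigroup_dom s f : 0 <= s -> dom L f ->
  dom L (T s f) /\ L (T s f) = T s (L f).
Proof.
move=> s0 Lf; have fl2 := dom_l2 Lf; have Lfl2 := app_l2 Lf.
have [_ gen] := T_semigroup.
apply/gen; [exact: semigroup_l2|exact: semigroup_l2|].
have [C C0 TC] := semigroup_bound s0.
apply: (@cvge0_le _ _ _ _ _ (fun h => wsq m (quotient h (T h f) f \- L f)%R) C).
- by move=> h; exact: wsq_ge0.
- by move=> h; exact: wsq_ge0.
- near=> h; have h0 : 0 <= h by apply: ltW; near: h; exact: nbhs_right_gt.
  have ThB : l2 (T h f \- f) by apply: wsqB_lty => //; exact: semigroup_l2.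
  rewrite -semigroupD// (addrC h) semigroupD//.
  rewrite (_ : (fun x => _) = T s (quotient h (T h f) f \- L f)).
    by apply: TC; apply: wsqB_lty => //; exact: wsqZ_lty.
  rewrite semigroupB//; last exact: wsqZ_lty.
  rewrite (_ : quotient h (T h f) f = fun x => h^-1 * (T h f \- f) x + 0); last first.
    by apply/funext => x; rewrite addr0.
  have z2 : l2 (fun _ : G => 0 : R) by apply: l2_C0; apply/C0P; exists fset0.
  rewrite semigroup_linear// semigroup_zero// semigroupB//; last exact: semigroup_l2.
  by apply/funext => x /=; ring.
- exact: generator_rderiv.
Unshelve. all: by end_near. Qed.

Lemma semigroup_rcont f : l2 f -> wcvg m (F := 0^'+) (fun h => T h f) f.
Proof. by have [[_ _ _ _ Tcont] _] := T_semigroup; exact: Tcont. Qed.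

Lemma semigroup_rderiv s f : 0 <= s -> dom L f ->
  wcvg m (F := 0^'+) (fun h => quotient h (T (s + h) f) (T s f)) (L (T s f)).
Proof.
move=> s0 Lf; have [LTf _] := semigroup_dom s0 Lf.
apply: (near_eq_wcvg c_ge0 _ (generator_rderiv LTf)); near=> h.
have h0 : 0 <= h by apply: ltW; near: h; exact: nbhs_right_gt.
by rewrite (addrC s) semigroupD//; exact: dom_l2 Lf.
Unshelve. all: by end_near. Qed.

(** Oscillation near time [s], restricted to nonnegative times because [T] is unspecified elsewhere.
    Letting both times vary makes the condition open in [s]. *)
Let close_at f (e s d : R) := 0 < d /\ forall r r' : R, 0 <= r -> 0 <= r' ->
  `|r - s| < d -> `|r' - s| < d -> (wsq m (T r f \- T r' f)%R <= e%:E)%E.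

(* Right continuity makes the set of times around which the oscillation is small
   open and dense, and a Baire argument yields a continuity point. *)
Let continuity_point f (s : R) : l2 f -> 0 < s ->
  exists2 s1, 0 < s1 < s & forall e, 0 < e -> exists d, close_at f e s1 d.
Proof.
move=> fl2 s_gt0.
pose U (n : nat) : set R := [set p | exists d, close_at f n.+1%:R^-1 p d].
have U_open n : open (U n).
  rewrite openE => p [d [d0 close]]; apply/nbhs_ballP.
  exists (d / 2); first by rewrite /= divr_gt0.
  move=> p' /= pp'; exists (d / 2); split=> [|r r' r0 r'0 rp r'p]; first by rewrite divr_gt0.
  have tri q : `|q - p'| < d / 2 -> `|q - p| < d.
    move=> qp; rewrite (_ : q - p = (q - p') - (p - p')); last by ring.
    apply: le_lt_trans (ler_normB _ _) _; rewrite [ltRHS]splitr.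
    by apply: ltrD.
  by apply: close => //; exact: tri.
have U_dense n (p e : R) : 0 < e -> exists q, `|p - q| < e /\ U n q.
  move=> e0; have [p0|p0] := ltP p 0.
    (* Around a negative time the condition is vacuous on a ball of radius [- p]. *)
    exists p; split; first by rewrite subrr normr0.
    exists (- p); split=> [|r r' r0 _]; first by rewrite oppr_gt0.
    by move=> rp; exfalso; move: rp; rewrite ger0_norm; lra.
  (* The triangle inequality [wsqD_le] costs a factor 2 on each of two terms, whence 4. *)
  have n0 : 0 < (n.+1%:R^-1 / 4 : R) by rewrite divr_gt0.
  have := (cvge0P (fun h => wsq_ge0 c_ge0 (T h (T p f) \- T p f))).1
    (semigroup_rcont (semigroup_l2 p0 fl2)) _ n0.
  move=> [d /= d0 close].
  have de : 0 < Num.min d e by rewrite lt_min d0.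
  (* The ball of radius [q] about [p + q] lies to the right of [p] and within [d] of it, where right
     continuity at [p] applies. *)
  set q := Num.min d e / 4.
  have q0 : 0 < q by rewrite divr_gt0.
  have [qd qe] : 4 * q <= d /\ 4 * q <= e.
    by rewrite /q mulrCA divff// mulr1 !ge_min !lexx orbT.
  exists (p + q); split.
    by rewrite opprD addrA subrr sub0r normrN gtr0_norm//; lra.
  exists q; split=> // r r' r0 r'0 rp r'p.
  have near_p t : `|t - (p + q)| < q ->
      (wsq m (T t f \- T p f)%R <= (n.+1%:R^-1 / 4)%:E)%E.
    rewrite ltr_norml => /andP[tl tr].
    have tp : 0 < t - p by lra.
    have := close (t - p); rewrite /= sub0r normrN gtr0_norm//.
    rewrite -semigroupD ?(ltW tp)// subrK; apply=> //.
    by lra.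
  have := wsqD_le c_ge0 (T r f \- T p f) (T p f \- T r' f).
  rewrite (_ : (fun x => _) = T r f \- T r' f); last by apply/funext => x /=; ring.
  move=> /le_trans; apply; rewrite (wsqB_sym m (T p f)).
  apply: (@le_trans _ _ (2%:E * (n.+1%:R^-1 / 4)%:E + 2%:E * (n.+1%:R^-1 / 4)%:E)%E).
    by apply: leeD; rewrite lee_pmul2l//; exact: near_p.
  by rewrite -!EFinM -EFinD lee_fin; move: (n.+1%:R^-1) => q'; lra.
have U_Baire n : open (U n : set R^o) /\ dense (U n : set R^o).
  split; first exact: U_open.
  move=> O [p Op] O_open; have /nbhs_ballP[e /= e0 ballO] : nbhs p O.
    exact: open_nbhs_nbhs.
  by have [q [pq Uq]] := U_dense n p e e0; exists q; split=> //; exact: ballO.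
have [||s1 [s1_in U_s1]] := Baire U_Baire (O := [set` `]0, s[] : set R).
- by exists (s / 2); rewrite /= in_itv /= divr_gt0//= ltr_pdivrMr//; lra.
- exact: itv_open.
exists s1; first by move: s1_in; rewrite /= in_itv.
move=> e e0; have [n ne] : exists n : nat, n.+1%:R^-1 <= e.
  have [n] := filter_ex (cvgr_le _ (@cvg_harmonic R) _ e0).
  by exists n.
have [d [d0 close]] := U_s1 n I; exists d; split=> // r r' r0 r'0 rp r'p.
by apply: le_trans (close r r' r0 r'0 rp r'p) _; rewrite lee_fin.
Qed.

(* [T s f = T (s - s1) (T s1 f)] carries continuity at [s1] to all later times. *)
Lemma semigroup_cont s f : 0 < s -> l2 f -> wcvg m (F := s^'-) (fun r => T r f) (T s f).
Proof.
move=> s_gt0 fl2; have [s1 /andP[s1_gt0 s1s] cont] := continuity_point fl2 s_gt0.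
have ss1 : 0 <= s - s1 by rewrite subr_ge0 ltW.
have [C C0 TC] := semigroup_bound ss1.
apply/(cvge0P (fun r => wsq_ge0 c_ge0 (T r f \- T s f))) => e e0.
have eC : 0 < e / (C + 1) by rewrite divr_gt0// ltr_wpDl.
have [d [d0 close]] := cont _ eC.
near=> r.
have rs : r < s by near: r; exact: nbhs_left_lt.
have rd : s - d < r by near: r; apply: nbhs_left_gt; rewrite ltrBlDr ltrDl.
have rs1 : s - s1 < r by near: r; apply: nbhs_left_gt; rewrite ltrBlDr ltrDl.
have r1 : 0 <= r - (s - s1) by rewrite subr_ge0 ltW.
have -> : T r f = T (s - s1) (T (r - (s - s1)) f).
  by rewrite -semigroupD// addrC subrK.
have -> : T s f = T (s - s1) (T s1 f).
  by rewrite -semigroupD ?subrK// ltW.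
rewrite -semigroupB//; [|exact: semigroup_l2|exact/semigroup_l2/fl2/ltW].
apply: le_trans (TC _ _) _.
  by apply: wsqB_lty => //; apply: semigroup_l2 => //; exact: ltW.
have cl : (wsq m (T (r - (s - s1)) f \- T s1 f)%R <= (e / (C + 1))%:E)%E.
  apply: close => //; [exact: ltW| |by rewrite subrr normr0].
  by rewrite ltr_norml; apply/andP; split; lra.
apply: le_trans (lee_wpmul2l _ cl) _; first by rewrite lee_fin.
rewrite -EFinM lee_fin mulrCA ler_piMr ?(ltW e0)//.
by rewrite ler_pdivrMr ?ltr_wpDl// mul1r lerDl.
Unshelve. all: by end_near. Qed.

End Semigroup.

(** * A maximum principle *)

Section MaximumPrinciple.
Context {R : realType} {G : weightedGraph R}.
Let c_ge0 := @m_ge0 _ G.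

(* A one-sided differential inequality suffices because [phi] is left-continuous:
   compare with [e * exp (M s)] at the first crossing time. *)
Lemma gronwall_right (phi : R -> R) (M : R) :
    phi 0 = 0 -> (forall s, 0 <= phi s) ->
    (forall s, 0 < s -> phi r @[r --> s^'-] --> phi s) ->
    (forall s b, 0 <= s -> phi s <= b -> 0 < b ->
      \forall h \near 0^'+, phi (s + h) <= b * (1 + M * h)) -> 0 <= M ->
  forall s, 0 <= s -> phi s = 0.
Proof.
move=> phi0 phi_ge0 phi_left phi_right M0 t t0.
suff below e : 0 < e -> phi t <= e * expR (M * t).
  apply/eqP; rewrite eq_le phi_ge0 andbT; apply/ler_addgt0Pr => z z0.
  rewrite add0r.
  have := below (z / expR (M * t)); rewrite divfK ?gt_eqF ?expR_gt0//.
  by apply; rewrite divr_gt0// expR_gt0.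
move=> e0; apply: contrapT => /negP; rewrite -ltNge => t_above.
pose A := [set s : R | 0 <= s /\ e * expR (M * s) < phi s].
have At : A t by [].
have infA : has_inf A by split; [exists t|exists 0 => s []].
set s := inf A.
have s0 : 0 <= s by apply: lb_le_inf; [exists t|move=> r []].
have before r : 0 <= r -> r < s -> phi r <= e * expR (M * r).
  move=> r0 rs; rewrite leNgt; apply/negP => r_above.
  by have := ge_inf infA.2 (conj r0 r_above : A r); rewrite leNgt rs.
(* Left continuity keeps the bound at the crossing time itself. *)
have at_s : phi s <= e * expR (M * s).
  move: s0; rewrite le_eqVlt => /predU1P[<-|s_gt0].
    by rewrite phi0 mulr_ge0 ?ltW// expR_gt0.
  apply: (cvgr_to_le (phi_left s s_gt0)); near=> r.
  have rs : r < s by near: r; exact: nbhs_left_lt.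
  have r0 : 0 < r by near: r; exact: nbhs_left_gt.
  apply: le_trans (before r (ltW r0) rs) _.
  by rewrite ler_pM2l// ler_expR ler_wpM2l// ltW.
have b0 : 0 < e * expR (M * s) by rewrite mulr_gt0 ?expR_gt0.
(* The right-hand inequality and [1 + x <= expR x] keep [phi] below the barrier just after [s],
   whereas the infimum is approached by crossing times from the right. *)
have [d /= d0 after] := phi_right s _ s0 at_s b0.
have [r [r0 r_above] rd] := inf_adherent d0 infA.
have sr : s <= r by apply: ge_inf => //; exact: infA.2.
have {}sr : s < r.
  rewrite lt_neqAle sr andbT; apply/eqP => sr'; move: r_above.
  by rewrite -sr' ltNge at_s.
have := after (r - s); rewrite /= sub0r normrN gtr0_norm ?subr_gt0//.
rewrite ltrBlDl => /(_ rd sr); rewrite (addrC s) subrK => after_r.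
have := lt_le_trans r_above after_r; rewrite ltNge => /negP; apply.
rewrite -mulrA ler_pM2l// (_ : M * r = M * s + M * (r - s)); last by ring.
by rewrite expRD ler_pM2l ?expR_gt0// expR_ge1Dx.
Unshelve. all: by end_near. Qed.

Lemma negpart_wcvg {I : Type} {F : set_system I} {FF : Filter F}
    (u : I -> G -> R) f :
  wcvg m (F := F) u f -> wcvg m (F := F) (fun i => negpart (u i)) (negpart f).
Proof.
apply: (wcvg_le c_ge0); apply: nearW => i x.
exact: negpart_dist_le.
Qed.

(** The squared norm of [z^-] obeys the Gronwall inequality above. It need not be differentiated:
    comparison with a quadratic expression in the difference quotient of [z] suffices. *)
Lemma maximum_principle (z z' : R -> G -> R) (c : R) :
    (forall s, 0 <= s -> l2 (z s)) -> (forall s, 0 <= s -> l2 (z' s)) ->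
    (forall s, 0 < s -> wcvg m (F := s^'-) z (z s)) ->
    (forall s, 0 <= s ->
       wcvg m (F := 0^'+) (fun h => quotient h (z (s + h)) (z s)) (z' s)) ->
    (forall s, 0 <= s ->
       c * l2_dot (negpart (z s)) (negpart (z s)) <= l2_dot (z' s) (negpart (z s))) ->
    (forall x, 0 <= z 0 x) ->
  forall s x, 0 <= s -> 0 <= z s x.
Proof.
move=> z_l2 z'_l2 z_left z_deriv z_dissip z0 s x s0.
pose phi r := wdot m (negpart (z r)) (negpart (z r)).
suff phi_s0 : phi s = 0.
  have : ((m x * negpart (z s) x ^+ 2)%:E <= (phi s)%:E)%E.
    rewrite wdotE//; last exact/l2_negpart/z_l2.
    apply: esum_ge; exists [set x]; first by split.
    by rewrite fsbig_set1.
  rewrite phi_s0 lee_fin pmulr_rle0 ?m_gt0// => neg_x.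
  have : negpart (z s) x ^+ 2 == 0 by rewrite eq_le neg_x sqr_ge0.
  rewrite sqrf_eq0 => /eqP neg_x0.
  have : - z s x <= negpart (z s) x by rewrite /negpart le_max lexx.
  by rewrite neg_x0 oppr_le0.
(* [2 |c|] comes from dissipativity; the extra 1 absorbs the second-order term [h * |q|^2]. *)
apply: (@gronwall_right phi (2 * `|c| + 1)) => //.
- rewrite /phi (_ : negpart (z 0) = fun=> 0).
    by rewrite /wdot (@usum_finite_support _ _ _ fset0) ?big_seq_fset0// => y _; ring.
  by apply/funext => y; rewrite /negpart; apply/max_idPr; rewrite oppr_le0.
- by move=> r; exact: wdot_sq_ge0.
- move=> r r0; apply: (wdot_sq_cvg c_ge0); first exact/l2_negpart/z_l2/ltW.
  exact/negpart_wcvg/z_left.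
- move=> r b r0 phi_b b0; set n := negpart (z r).
  have nl2 : l2 n by exact/l2_negpart/z_l2.
  pose q h := quotient h (z (r + h)) (z r).
  have lim : (-2 * wdot m (q h) n + h * wdot m (q h) (q h)) @[h --> 0^'+] -->
      -2 * wdot m (z' r) n + 0 * wdot m (z' r) (z' r).
    apply: cvgD.
      apply: cvgMr; exact: (wdot_cvg c_ge0 (z'_l2 _ r0) nl2 (z_deriv _ r0)).
    apply: cvgM; first by apply: cvg_at_right_filter; exact: cvg_id.
    exact: (wdot_sq_cvg c_ge0 (z'_l2 _ r0) (z_deriv _ r0)).
  have slope : -2 * wdot m (z' r) n + 0 * wdot m (z' r) (z' r) < 2 * `|c| * b + b.
    have diss : c * phi r <= wdot m (z' r) n by exact: z_dissip.
    have phi_r0 : 0 <= phi r by exact: wdot_sq_ge0.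
    have : - c * phi r <= `|c| * b.
      apply: (@le_trans _ _ (`|c| * phi r)).
        by rewrite ler_wpM2r// -normrN ler_norm.
      by rewrite ler_wpM2l.
    by rewrite mulNr; lra.
  have := cvgr_le _ lim _ slope => slope_near; near=> h.
  have h0 : 0 < h by near: h; exact: nbhs_right_gt.
  have h_slope : -2 * wdot m (q h) n + h * wdot m (q h) (q h) <= 2 * `|c| * b + b.
    by near: h; exact: slope_near.
  have zrh : l2 (z (r + h)) by apply: z_l2; rewrite addr_ge0// ltW.
  have zr := z_l2 _ r0.
  have dl2 : l2 (z (r + h) \- z r) by exact: wsqB_lty.
  have ql2 : l2 (q h) by exact: wsqZ_lty.
  have hq : z (r + h) \- z r = fun y => h * q h y.
    by apply/funext => y; rewrite /q /quotient mulVKf// gt_eqF.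
  (* Since [n >= - z r], the function [n - (z (r + h) - z r)] dominates [- z (r + h)], hence its
     absolute value dominates the negative part at time [r + h]. *)
  apply: (@le_trans _ _ (wdot m (n \- (z (r + h) \- z r)) (n \- (z (r + h) \- z r)))).
    rewrite -lee_fin !wdotE//; [|exact: wsqB_lty|exact: l2_negpart].
    apply: (wsq_le c_ge0) => y; rewrite (ger0_norm (negpart_ge0 _ _)) /n /negpart /=.
    rewrite ge_max normr_ge0 andbT; apply: le_trans (ler_norm _).
    have : - z r y <= Num.max (- z r y) 0 by rewrite le_max lexx.
    by lra.
  have nB : l2 (n \- (fun y => h * q h y)) by apply: wsqB_lty => //; exact: wsqZ_lty.
  have hql2 : l2 (fun y => h * q h y) by exact: wsqZ_lty.
  rewrite hq (wdotBl c_ge0 nl2 hql2 nB) !(wdotBr c_ge0 nl2 hql2)//.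
  rewrite (wdotZl c_ge0 h ql2 nl2) (wdotC m n) (wdotZl c_ge0 h ql2 nl2).
  rewrite (wdotZl c_ge0 h ql2 hql2) (wdotZr c_ge0 h ql2 ql2) -/(phi r).
  have := ler_wpM2l (ltW h0) h_slope; nra.
Unshelve. all: by end_near. Qed.

End MaximumPrinciple.

(** * Positivity and the heat kernel *)

Section HeatSemigroup.
Context {R : realType} {G : weightedGraph R}.
Variables (eta : nat -> G -> R) (etaP : cutoff eta).
Variables (L : l2_operator G) (T : R -> (G -> R) -> G -> R).
Hypotheses (L_generator : form_generator L) (T_semigroup : exp_semigroup L T).
Implicit Types (f g : G -> R) (s t : R).

Let c_ge0 := @m_ge0 _ G.

(** [<L u, u^-> = - Q(u, u^-) >= 0], so the maximum principle applies with [c = 0]. *)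
Let positivity_C0 f s x : C0 f -> (forall y, 0 <= f y) -> 0 <= s -> 0 <= T s f x.
Proof.
move=> f0 f_ge0 s0; have [Lf _] := generator_C0 etaP L_generator f0.
have dom_Tf r : 0 <= r -> dom L (T r f) /\ _ := fun r0 => semigroup_dom T_semigroup r0 Lf.
have fl2 := dom_l2 Lf.
apply: (maximum_principle (z := fun r => T r f) (z' := fun r => L (T r f)) (c := 0)) => //.
- by move=> r r0; exact: (semigroup_l2 T_semigroup).
- by move=> r /dom_Tf[Lr _]; exact: app_l2.
- by move=> r r0; exact: (semigroup_cont T_semigroup).
- by move=> r r0; exact: semigroup_rderiv.
- move=> r /dom_Tf[Lr _]; have DQr := generator_DQ L_generator Lr.
  rewrite mul0r (generator_form L_generator Lr (DQ_negpart etaP DQr)) oppr_ge0.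
  exact: Q_negpart_le0.
- by move=> y; rewrite (semigroup0 T_semigroup).
Qed.

Lemma cutoff_mul_l2 f k : l2 (fun x => eta k x * f x).
Proof. exact/l2_C0/C0_mull/(cutoff_C0 etaP). Qed.

Lemma semigroup_cutoff_cvg f t x : 0 <= t -> l2 f ->
  T t (fun x => eta k x * f x) x @[k --> \oo] --> T t f x.
Proof.
move=> t0 fl2; exact: (wcvg_at c_ge0 (m_gt0 x) (semigroup_wcvg T_semigroup t0 fl2
  (cutoff_mul_l2 f) (cutoff_wcvg etaP fl2))).
Qed.

Lemma semigroup_positivity f t x : l2 f -> (forall y, 0 <= f y) -> 0 <= t ->
  0 <= T t f x.
Proof.
move=> fl2 f_ge0 t0; apply: (cvgr_to_ge (semigroup_cutoff_cvg (x := x) t0 fl2)).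
apply: nearW => k; apply: positivity_C0 => //; first exact/C0_mull/(cutoff_C0 etaP).
by move=> y; rewrite mulr_ge0// (cutoff_ge0 etaP).
Qed.

Lemma semigroup_finite_sum f t (X : seq G) : 0 <= t ->
  T t (fun z => \sum_(y <- X) f y * delta y z)
  = (fun z => \sum_(y <- X) f y * T t (delta y) z).
Proof.
move=> t0; elim: X => [|y X IH].
  rewrite (_ : (fun z => _) = fun=> 0); last by apply/funext => z; rewrite big_nil.
  by rewrite (semigroup_zero T_semigroup t0); apply/funext => z; rewrite big_nil.
rewrite (_ : (fun z => _) =
    fun z => f y * delta y z + \sum_(y <- X) f y * delta y z); last first.
  by apply/funext => z; rewrite big_cons.
rewrite (semigroup_linear T_semigroup) ?IH//.
- by apply/funext => z; rewrite big_cons.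
- exact/l2_C0/delta_C0.
- apply: l2_C0; apply/C0P; exists [fset y in X]%fset => z; rewrite in_fset => /= zX.
  rewrite big_seq big1// => y' y'X; rewrite /delta; case: eqP => [zy'|]; last by rewrite mulr0.
  by rewrite zy' y'X in zX.
Qed.

Lemma sum_delta f (X : {fset G}) z :
  \sum_(y <- X) f y * delta y z = (z \in X)%:R * f z.
Proof.
have [zX|zX] := boolP (z \in X).
  rewrite (big_fsetD1 z)//= /delta eqxx mulr1 mul1r big_seq big1 ?addr0// => y.
  by rewrite in_fsetD1 eq_sym => /andP[/negbTE -> _]; rewrite mulr0.
rewrite mul0r big_seq big1// => y yX; rewrite /delta.
by case: eqP => [zy|]; rewrite ?mulr0//; move: zX; rewrite zy yX.
Qed.

Let kernel_ge0 t x y : 0 <= t -> 0 <= T t (delta y) x.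
Proof.
by move=> t0; apply: semigroup_positivity => //; exact/l2_C0/delta_C0.
Qed.

(** Partial sums are values of [T t] at truncations of [f], so positivity bounds them above by
    [T t f x]; the functions [eta k * f <= f] give the converse in the limit. *)
Let esum_kernel f t x : l2 f -> (forall y, 0 <= f y) -> 0 <= t ->
  (\esum_(y in [set: G]) (T t (delta y) x * f y)%:E = (T t f x)%:E)%E.
Proof.
move=> fl2 f_ge0 t0; apply/eqP; rewrite eq_le; apply/andP; split.
  apply: ge_ereal_sup => _ [Y [finY _] <-].
  rewrite fsbig_finite//= sumEFin lee_fin.
  set X := fset_set Y; under eq_bigr do rewrite mulrC.
  pose fX z := \sum_(y <- X) f y * delta y z.
  have -> : \sum_(y <- X) f y * T t (delta y) x = T t fX x by rewrite semigroup_finite_sum.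
  have fXl2 : l2 fX.
    by apply: l2_C0; apply/C0P; exists X => z zX; rewrite /fX sum_delta (negbTE zX) mul0r.
  rewrite -subr_ge0 -[leRHS]/((T t f \- T t fX) x) -(semigroupB T_semigroup)//.
  apply: semigroup_positivity => //; first exact: wsqB_lty.
  by move=> y /=; rewrite /fX sum_delta; case: (y \in X); rewrite ?mul1r ?subrr// mul0r subr0.
have [fin|] := boolP (\esum_(y in [set: G]) (T t (delta y) x * f y)%:E \is a fin_num)%E;
    last first.
  rewrite ge0_fin_numE; last by apply: esum_ge0 => y _; rewrite lee_fin mulr_ge0 ?kernel_ge0.
  by rewrite -leNgt leye_eq => /eqP ->; rewrite leey.
rewrite -(fineK fin) lee_fin; apply: (cvgr_to_le (semigroup_cutoff_cvg (x := x) t0 fl2)).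
apply: nearW => k; rewrite -lee_fin (fineK fin).
have /C0P[X etaX] := cutoff_C0 etaP k.
rewrite (_ : (fun x => _) = fun z => \sum_(y <- X) (eta k y * f y) * delta y z); last first.
  apply/funext => z; rewrite sum_delta.
  by have [_|/etaX ->] := boolP (z \in X); rewrite ?mul1r// !mul0r.
rewrite (semigroup_finite_sum (fun y => eta k y * f y))//.
apply: esum_ge; exists [set` X]; first by split.
rewrite fsbig_finite//= set_fsetK sumEFin lee_fin; apply: ler_sum => y _.
rewrite mulrC ler_wpM2l ?kernel_ge0// -[leRHS]mul1r ler_wpM2r//.
exact: cutoff_le1 etaP k y.
Qed.

(** Splitting [f] into positive and negative parts makes both kernel sums nonnegative and finite, as
    the signed [usum] requires. *)
Lemma heatE f t : l2 f -> 0 <= t -> heat T t f = T t f.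
Proof.
move=> fl2 t0; apply/funext => x.
have Nfl2 : l2 (fun x => - f x) by rewrite l2E wsqN.
have nl2 := l2_negpart fl2; have pl2 := l2_negpart Nfl2.
set p := negpart (fun x => - f x) in pl2.
have p0 y : 0 <= p y by exact: negpart_ge0.
have n0 := negpart_ge0 f.
have fE : f = p \- negpart f.
  apply/funext => y; rewrite /p /negpart /= opprK.
  by case: (leP (f y) 0) => h; [rewrite max_l|rewrite max_r]; lra.
have summable_kernel g : l2 g -> (forall y, 0 <= g y) ->
    summable [set: G] (EFin \o (fun y => T t (delta y) x * g y)).
  move=> gl2 g0; apply: (@abs_summable_le _ _ _ (fun y => T t (delta y) x * g y)).
    by move=> y; rewrite ger0_norm// mulr_ge0// kernel_ge0.
  by rewrite esum_kernel// ltry.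
transitivity (usum (fun y => T t (delta y) x * p y - T t (delta y) x * negpart f y)).
  congr usum; apply/funext => y; rewrite /heat_kernel -/(delta y) {1}fE /=.
  by field; rewrite m_neq0.
rewrite usumB_ge0; try exact: summable_kernel; try by move=> y; rewrite mulr_ge0 ?kernel_ge0.
by rewrite !esum_kernel//= {2}fE (semigroupB T_semigroup).
Qed.

End HeatSemigroup.

(** * The carre du champ along the semigroup *)

Lemma cvg_expR_rderiv (R : realType) (a s : R) :
  (h^-1 * (expR (a * (s + h)) - expR (a * s))) @[h --> 0^'+] --> a * expR (a * s).
Proof.
have Dg : is_derive s 1 (fun r : R => a * r) a.
  by apply: is_derive_eq; rewrite [LHS]mulr1.
have D := is_derive1_comp (is_derive_expR (a * s)) Dg.
have lim := cvg_dnbhs_at_right (ex_derive (is_derive := D)).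
move: lim; rewrite -[lim _]/('D_1 _ s) (derive_val (is_derive := D)).
rewrite (mulrC (expR _)); apply: cvg_trans; apply: near_eq_cvg; apply: nearW => h.
by rewrite /= /GRing.scale /= mulr1 (addrC s).
Qed.

Section GammaLimits.
Context {R : realType} {G : weightedGraph R}.
Variables (m0 : R) (m0_gt0 : 0 < m0) (m_ge : forall x : G, m0 <= m x).
Implicit Types f g : G -> R.
Let c_ge0 := @m_ge0 _ G.

Local Notation fin_energy f := (wsq mu2 (grad f) < +oo)%E.

Lemma gradB f g : grad (f \- g) = grad f \- grad g.
Proof. by apply/funext => p; rewrite /grad /=; ring. Qed.

Lemma energy_wdot f : fin_energy f ->
  energy f = (2^-1 * wdot mu2 (grad f) (grad f))%:E.
Proof. by move=> fE; rewrite energyE -(wdotE mu2_ge0 fE) -EFinM. Qed.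

Lemma energy_le_wsq f : (energy f <= 1%:E * wsq mu2 (grad f))%E.
Proof.
rewrite energyE; apply: lee_wpmul2r; first exact: wsq_ge0 mu2_ge0 _.
by rewrite lee_fin invf_le1// ler1n.
Qed.

Lemma Gamma_l2 f g : fin_energy f -> fin_energy g -> l2 (Gamma f g).
Proof.
move=> fE gE.
have fE_le : (energy f <= (2^-1 * wdot mu2 (grad f) (grad f))%:E)%E by rewrite energy_wdot.
apply: le_lt_trans (l2_normsq_Gamma_le g m0_gt0 m_ge fE_le) _.
by rewrite (energy_wdot gE) -EFinM ltry.
Qed.

(** Bilinearity splits the error into [Gamma(v, u - f) + Gamma(f, v - g)], and each term is bounded
    in [l2] by a product of energies. *)
Lemma Gamma_wcvg {I : Type} {F : set_system I} {FF : Filter F} (u v : I -> G -> R) f g :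
    fin_energy f -> fin_energy g ->
    wcvg mu2 (F := F) (fun i => grad (u i)) (grad f) ->
    wcvg mu2 (F := F) (fun i => grad (v i)) (grad g) ->
  wcvg m (F := F) (fun i => Gamma (u i) (v i)) (Gamma f g).
Proof.
move=> fE gE uf vg.
have GammaBB i : Gamma (u i) (v i) \- Gamma f g =
    fun x => Gamma (v i) (u i \- f) x + Gamma f (v i \- g) x.
  apply/funext => x /=; rewrite (GammaC (v i)).
  have sub (a b c : G -> R) : Gamma (a \- b) c x = Gamma a c x - Gamma b c x.
    rewrite (_ : a \- b = fun y => a y + -1 * b y) ?GammaDl ?GammaZl; first by ring.
    by apply/funext => y /=; ring.
  by rewrite (GammaC f (v i \- g)) !sub (GammaC _ f) (GammaC g f); ring.
have step_energy (w : I -> G -> R) h :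
    wcvg mu2 (F := F) (fun i => grad (w i)) (grad h) ->
    (fun i => energy (w i \- h)) @ F --> 0%E.
  move=> wh; apply: (@cvge0_le _ _ _ _ _ (fun i => wsq mu2 (grad (w i) \- grad h)%R) 1) => //.
  - by move=> i; exact: energy_ge0.
  - by move=> i; exact: wsq_ge0 mu2_ge0 _.
  - by apply: nearW => i; rewrite -gradB; exact: energy_le_wsq.
rewrite /wcvg; under eq_fun do rewrite GammaBB.
(* An eventual bound on the energy of [v i], from [|grad v|^2 <= 2 |grad (v - g)|^2 + 2 |grad
   g|^2]. *)
pose b := 2 * (wdot mu2 (grad g) (grad g) + 1).
apply: (@cvge0_le _ _ _ _ _ (fun i => wsq m (Gamma (v i) (u i \- f)%R) +
   wsq m (Gamma f (v i \- g)%R))%E 2).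
- by move=> i; exact: wsq_ge0.
- by move=> i; rewrite adde_ge0// wsq_ge0.
- apply: nearW => i; rewrite muleDr ?ge0_adde_def ?inE ?wsq_ge0//.
  exact: wsqD_le.
apply: cvge0D; try by move=> i; exact: wsq_ge0.
  apply: (@cvge0_le _ _ _ _ _ (fun i => energy (u i \- f)) (b / m0)).
  - by move=> i; exact: wsq_ge0.
  - by move=> i; exact: energy_ge0.
  - have v_near := (cvge0P (fun i => wsq_ge0 mu2_ge0 (grad (v i) \- grad g))).1 vg 1 ltr01.
    near=> i; have vi : (wsq mu2 (grad (v i) \- grad g)%R <= 1%:E)%E.
      by near: i; exact: v_near.
    apply: l2_normsq_Gamma_le => //.
    apply: (le_trans (energy_le_wsq _)); rewrite mul1e.
    rewrite (_ : grad (v i) = fun p => (grad (v i) \- grad g) p + grad g p); last first.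
      by apply/funext => p /=; ring.
    apply: (le_trans (wsqD_le mu2_ge0 _ _)).
    rewrite -(wdotE mu2_ge0 gE).
    apply: (@le_trans _ _ (2%:E * 1%:E + 2%:E * (wdot mu2 (grad g) (grad g))%:E)%E).
      by rewrite leeD// lee_pmul2l.
    by rewrite -!EFinM -EFinD lee_fin /b; lra.
  - exact: step_energy.
apply: (@cvge0_le _ _ _ _ _ (fun i => energy (v i \- g))
  (2^-1 * wdot mu2 (grad f) (grad f) / m0)).
- by move=> i; exact: wsq_ge0.
- by move=> i; exact: energy_ge0.
- by apply: nearW => i; apply: l2_normsq_Gamma_le => //; rewrite energy_wdot.
- exact: step_energy.
Unshelve. all: by end_near. Qed.

Lemma Gamma_cvg {I : Type} {F : set_system I} {FF : Filter F} (u : I -> G -> R) f x :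
  (forall y, u i y @[i --> F] --> f y) ->
  Gamma (u i) (u i) x @[i --> F] --> Gamma f f x.
Proof.
move=> uf; rewrite (GammaE f f (fun y (yx : y \in nbrs x) => yx)).
under eq_fun do rewrite (GammaE _ _ (fun y (yx : y \in nbrs x) => yx)).
apply: cvgMr; apply: cvg_big => [|y _]; first exact: add_continuous.
have du : u i y - u i x @[i --> F] --> f y - f x by apply: cvgB; exact: uf.
by apply: cvgM => //; apply: cvgMr.
Qed.

(** The difference of squares for the symmetric form [Gamma]; it leaves a single difference
    quotient, whose limit is taken in the energy norm. *)
Lemma quotient_Gamma h f g :
  quotient h (Gamma f f) (Gamma g g) = Gamma (fun x => f x + g x) (quotient h f g).
Proof.
apply/funext => x; rewrite /quotient GammaZr GammaDl.
have sub (a b c : G -> R) : Gamma a (fun y => b y - c y) x = Gamma a b x - Gamma a c x.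
  rewrite (_ : (fun y => _) = fun y => b y + -1 * c y) ?GammaDr ?GammaZr; first by ring.
  by apply/funext => y /=; ring.
by rewrite !sub (GammaC g f); ring.
Qed.

Lemma quotient_prod_wcvg (a : R -> R) (a' s : R) (p : R -> G -> R) (p' : G -> R) :
    l2 (p s) -> l2 p' -> a (s + h) @[h --> 0^'+] --> a s ->
    h^-1 * (a (s + h) - a s) @[h --> 0^'+] --> a' ->
    wcvg m (F := 0^'+) (fun h => quotient h (p (s + h)) (p s)) p' ->
  wcvg m (F := 0^'+)
    (fun h => quotient h (fun x => a (s + h) * p (s + h) x) (fun x => a s * p s x))
    (fun x => a s * p' x + a' * p s x).
Proof.
move=> ps_l2 p'_l2 a_cont a_deriv p_deriv.
have lim := wcvgD c_ge0 (wcvgZ c_ge0 p'_l2 a_cont p_deriv)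
  (wcvgZ c_ge0 ps_l2 a_deriv (wcvg_cst m (p s))).
rewrite (_ : (fun h => _) = fun h x => a (s + h) * quotient h (p (s + h)) (p s) x +
    h^-1 * (a (s + h) - a s) * p s x); first exact: lim.
by apply/funext => h; apply/funext => x; rewrite /quotient; ring.
Qed.

End GammaLimits.

(** * Evolution of the gap between the two sides of the gradient bound *)

Section GradientBound.
Context {R : realType} {G : weightedGraph R}.
Variables (eta : nat -> G -> R) (etaP : cutoff eta).
Variables (m0 : R) (m0_gt0 : 0 < m0) (m_ge : forall x : G, m0 <= m x).
Variables (L : l2_operator G) (T : R -> (G -> R) -> G -> R) (K : R).
Hypotheses (L_generator : form_generator L) (T_semigroup : exp_semigroup L T).
Implicit Types (f g : G -> R) (s t : R).

Let c_ge0 := @m_ge0 _ G.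

Local Notation fin_energy f := (wsq mu2 (grad f) < +oo)%E.

Lemma generator_comb a b f g : dom L f -> dom L g ->
  dom L (fun x => a * f x + b * g x) /\
  L (fun x => a * f x + b * g x) = (fun x => a * L f x + b * L g x).
Proof.
move=> Lf Lg.
have bgE (h : G -> R) : (fun x => b * h x) = (fun x => (b - 1) * h x + h x).
  by apply/funext => x; ring.
have Lbg : dom L (fun x => b * g x) by rewrite bgE; exact: dom_linear.
have LbgE : L (fun x => b * g x) = (fun x => b * L g x).
  by rewrite (bgE g) app_linear// (bgE (L g)).
by split; [exact: dom_linear|rewrite app_linear// LbgE].
Qed.

Lemma dom_sub f g : dom L f -> dom L g ->
  dom L (f \- g) /\ L (f \- g) = L f \- L g.
Proof.
move=> Lf Lg; have := generator_comb 1 (- 1) Lf Lg.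
have subE (a b : G -> R) : a \- b = (fun x => 1 * a x + - 1 * b x).
  by apply/funext => x /=; ring.
by rewrite -!subE.
Qed.

Lemma dom_quotient h f g : dom L f -> dom L g ->
  dom L (quotient h f g) /\ L (quotient h f g) = quotient h (L f) (L g).
Proof.
move=> Lf Lg; have := generator_comb h^-1 (- h^-1) Lf Lg.
have quotE (a b : G -> R) : quotient h a b = (fun x => h^-1 * a x + - h^-1 * b x).
  by apply/funext => x; rewrite /quotient; ring.
by rewrite -!quotE.
Qed.

Lemma dom_grad_wcvg {I : Type} {F : set_system I} {FF : Filter F} (u : I -> G -> R) f :
    dom L f -> (\forall i \near F, dom L (u i)) -> wcvg m (F := F) u f ->
    wcvg m (F := F) (fun i => L (u i)) (L f) ->
  wcvg mu2 (F := F) (fun i => grad (u i)) (grad f).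
Proof.
move=> Lf Lu uf LuLf.
apply: (@cvge0_le _ _ _ _ _ (fun i => wsq m (u i \- f)%R + wsq m (L (u i) \- L f)%R)%E 1).
- by move=> i; exact: wsq_ge0 mu2_ge0 _.
- by move=> i; rewrite adde_ge0// wsq_ge0.
- apply: filterS Lu => i Lui; have [Luf LufE] := dom_sub Lui Lf.
  by rewrite mul1e -gradB -LufE; exact: (generator_energy_le etaP L_generator).
- by apply: cvge0D => // i; exact: wsq_ge0.
Qed.

Lemma dom_fin_energy f : dom L f -> fin_energy f.
Proof. by move=> /(generator_DQ L_generator) /(DQP etaP)[]. Qed.

Section C0Initial.
Variables (f : G -> R) (f_C0 : C0 f).

Let u s := T s f.
Let w s := Gamma (u s) (u s).
Let p s := T s (Gamma f f).
Let e s := expR (- 2 * K * s).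

(* [gap] is the function [z] of the introduction. *)
Definition gap s x := e s * p s x - w s x.
Definition gap_deriv s x :=
  e s * L (p s) x + - 2 * K * e s * p s x - 2 * Gamma (u s) (L (u s)) x.

Let dom_f : dom L f. Proof. exact: (generator_C0 etaP L_generator f_C0).1. Qed.
(** The Laplacian preserves finite support. This puts [L (u s) = T s (L f)] in the domain again, so
    that [Gamma (u s) (L (u s))] is in [l2] and [u] is differentiable in the energy norm. *)
Let dom_Lf : dom L (L f).
Proof.
have [_ ->] := generator_C0 etaP L_generator f_C0.
exact: (generator_C0 etaP L_generator (C0_laplacian f_C0)).1.
Qed.
Let dom_Gf : dom L (Gamma f f).
Proof. exact: (generator_C0 etaP L_generator (C0_Gamma f_C0)).1. Qed.

Let dom_u s : 0 <= s -> dom L (u s).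
Proof. by move=> s0; exact: (semigroup_dom T_semigroup s0 dom_f).1. Qed.
Let L_u s : 0 <= s -> L (u s) = T s (L f).
Proof. by move=> s0; exact: (semigroup_dom T_semigroup s0 dom_f).2. Qed.
Let dom_Lu s : 0 <= s -> dom L (L (u s)).
Proof. by move=> s0; rewrite L_u//; exact: (semigroup_dom T_semigroup s0 dom_Lf).1. Qed.
Let dom_p s : 0 <= s -> dom L (p s).
Proof. by move=> s0; exact: (semigroup_dom T_semigroup s0 dom_Gf).1. Qed.

Let w_l2 s : 0 <= s -> l2 (w s).
Proof. by move=> /dom_u/dom_fin_energy uE; exact: (Gamma_l2 m0_gt0 m_ge). Qed.
Let GuLu_l2 s : 0 <= s -> l2 (Gamma (u s) (L (u s))).
Proof.
move=> s0; apply: (Gamma_l2 m0_gt0 m_ge); first exact/dom_fin_energy/dom_u.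
exact/dom_fin_energy/dom_Lu.
Qed.

Let near_right_ge0 s : 0 <= s -> \forall h \near 0^'+, 0 <= s + h.
Proof.
move=> s0; near=> h; rewrite addr_ge0// ltW//; near: h; exact: nbhs_right_gt.
Unshelve. all: by end_near. Qed.

Let near_left_ge0 s : 0 < s -> \forall r \near s^'-, 0 <= r.
Proof.
by move=> s0; near=> r; rewrite ltW//; near: r; exact: nbhs_left_gt.
Unshelve. all: by end_near. Qed.

Let grad_u_left s : 0 < s -> wcvg mu2 (F := s^'-) (fun r => grad (u r)) (grad (u s)).
Proof.
move=> s0; apply: dom_grad_wcvg; first exact/dom_u/ltW.
- by apply: filterS (near_left_ge0 s0) => r /dom_u.
- exact: (semigroup_cont T_semigroup s0 (dom_l2 dom_f)).
- rewrite (L_u (ltW s0)).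
  apply: (near_eq_wcvg c_ge0 _ (semigroup_cont T_semigroup s0 (dom_l2 dom_Lf))).
  by apply: filterS (near_left_ge0 s0) => r /L_u.
Qed.

Let grad_u_rderiv s : 0 <= s ->
  wcvg mu2 (F := 0^'+) (fun h => grad (quotient h (u (s + h)) (u s))) (grad (L (u s))).
Proof.
move=> s0; apply: dom_grad_wcvg; first exact: dom_Lu.
- apply: filterS (near_right_ge0 s0) => h sh.
  exact: (dom_quotient h (dom_u sh) (dom_u s0)).1.
- exact: semigroup_rderiv.
- rewrite (L_u s0).
  apply: (near_eq_wcvg c_ge0 _ (semigroup_rderiv T_semigroup s0 dom_Lf)).
  apply: filterS (near_right_ge0 s0) => h sh.
  by rewrite (dom_quotient h (dom_u sh) (dom_u s0)).2 !L_u.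
Qed.

Let grad_u_right s : 0 <= s ->
  wcvg mu2 (F := 0^'+) (fun h => grad (u (s + h))) (grad (u s)).
Proof.
move=> s0; have h_to0 : (h : R) @[h --> 0^'+] --> (0 : R).
  by apply: cvg_at_right_filter; exact: cvg_id.
have lim : wcvg mu2 (F := 0^'+)
    (fun h q => h * grad (quotient h (u (s + h)) (u s)) q + grad (u s) q)
    (fun q => 0 * grad (L (u s)) q + grad (u s) q).
  exact: (wcvgD mu2_ge0 (wcvgZ mu2_ge0 (dom_fin_energy (dom_Lu s0)) h_to0
    (grad_u_rderiv s0)) (wcvg_cst mu2 (grad (u s)))).
rewrite (_ : grad (u s) = fun q => 0 * grad (L (u s)) q + grad (u s) q); last first.
  by apply/funext => q; ring.
apply: (near_eq_wcvg mu2_ge0 _ lim); near=> h; apply/funext => q.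
have h0 : h != 0 by rewrite gt_eqF//; near: h; exact: nbhs_right_gt.
by rewrite /grad /quotient; field.
Unshelve. all: by end_near. Qed.

Let w_rderiv s : 0 <= s -> wcvg m (F := 0^'+)
  (fun h => quotient h (w (s + h)) (w s)) (fun x => 2 * Gamma (u s) (L (u s)) x).
Proof.
move=> s0; have uE := dom_fin_energy (dom_u s0).
have LuE := dom_fin_energy (dom_Lu s0).
have sum_grad : wcvg mu2 (F := 0^'+) (fun h => grad (fun x => u (s + h) x + u s x))
    (grad (fun x => u s x + u s x)).
  have gradD (a b : G -> R) : grad (fun x => a x + b x) = fun q => grad a q + grad b q.
    by apply/funext => q; rewrite /grad; ring.
  under eq_fun do rewrite gradD; rewrite gradD.
  exact: (wcvgD mu2_ge0 (grad_u_right s0) (wcvg_cst mu2 _)).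
have uuE : fin_energy (fun x => u s x + u s x)%R.
  have [Luu _] := generator_comb 1 1 (dom_u s0) (dom_u s0).
  rewrite (_ : (fun x => _) = fun x => 1 * u s x + 1 * u s x); first exact: dom_fin_energy.
  by apply/funext => x; rewrite !mul1r.
rewrite (_ : (fun x => 2 * _) = Gamma (fun x => u s x + u s x) (L (u s))); last first.
  by apply/funext => x; rewrite GammaDl; ring.
rewrite (_ : (fun h => quotient h _ _) = fun h =>
    Gamma (fun x => u (s + h) x + u s x) (quotient h (u (s + h)) (u s))); last first.
  by apply/funext => h; exact: quotient_Gamma.
exact: (Gamma_wcvg m0_gt0 m_ge uuE LuE sum_grad (grad_u_rderiv s0)).
Qed.

Lemma gap_rderiv s : 0 <= s ->
  wcvg m (F := 0^'+) (fun h => quotient h (gap (s + h)) (gap s)) (gap_deriv s).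
Proof.
move=> s0; have pl2 := dom_l2 (dom_p s0); have Lpl2 := app_l2 (dom_p s0).
have e_deriv := @cvg_expR_rderiv _ (- 2 * K) s.
have e_cont : e (s + h) @[h --> 0^'+] --> e s.
  have h_to0 : (h : R) @[h --> 0^'+] --> (0 : R).
    by apply: cvg_at_right_filter; exact: cvg_id.
  have lim : h * (h^-1 * (expR (- 2 * K * (s + h)) - expR (- 2 * K * s))) + e s
      @[h --> 0^'+] --> 0 * (- 2 * K * expR (- 2 * K * s)) + e s.
    by apply: cvgD; [exact: cvgM|exact: cvg_cst].
  move: lim; rewrite mul0r add0r; apply: cvg_trans; apply: near_eq_cvg; near=> h.
  have h0 : h != 0 by rewrite gt_eqF//; near: h; exact: nbhs_right_gt.
  by rewrite mulVKf// /e subrK.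
rewrite (_ : (fun h => quotient h _ _) = fun h x =>
    quotient h (fun x => e (s + h) * p (s + h) x) (fun x => e s * p s x) x
    - quotient h (w (s + h)) (w s) x); last first.
  by apply/funext => h; apply/funext => x; rewrite /quotient /gap; ring.
exact: (wcvgB c_ge0 (quotient_prod_wcvg pl2 Lpl2 e_cont e_deriv
  (semigroup_rderiv T_semigroup s0 dom_Gf)) (w_rderiv s0)).
Unshelve. all: by end_near. Qed.

Lemma gap0 x : gap 0 x = 0.
Proof.
rewrite /gap /e /p /w /u mulr0 expR0 mul1r !(semigroup0 T_semigroup) ?subrr//.
  exact: dom_l2 dom_f.
exact: dom_l2 dom_Gf.
Qed.

Lemma gap_deriv0 x : gap_deriv 0 x = 2 * (Gamma2 f x - K * Gamma f f x).
Proof.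
rewrite /gap_deriv /e /p /u mulr0 expR0 mul1r mulr1.
rewrite (semigroup0 T_semigroup (dom_l2 dom_f)) (semigroup0 T_semigroup (dom_l2 dom_Gf)).
rewrite (generator_laplacian etaP L_generator dom_f).
rewrite (generator_laplacian etaP L_generator dom_Gf) /Gamma2.
by field.
Qed.

Lemma gap_ge0_CD : (forall t, 0 <= t -> forall x, 0 <= gap t x) ->
  forall x, K * Gamma f f x <= Gamma2 f x.
Proof.
move=> gap_ge0 x; rewrite -subr_ge0 -(pmulr_rge0 _ (ltr0n R 2)) -gap_deriv0.
apply: (cvgr_to_ge (wcvg_at c_ge0 (m_gt0 x) (gap_rderiv (lexx 0)))).
near=> h; have h0 : 0 <= h by apply: ltW; near: h; exact: nbhs_right_gt.
by rewrite /quotient gap0 subr0 mulr_ge0 ?invr_ge0// gap_ge0// addr_ge0.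
Unshelve. all: by end_near. Qed.

Let gap_l2 s : 0 <= s -> l2 (gap s).
Proof.
move=> s0; apply: (wsqB_lty c_ge0); last exact: w_l2.
exact/(wsqZ_lty c_ge0)/dom_l2/dom_p.
Qed.

Let gap_deriv_l2 s : 0 <= s -> l2 (gap_deriv s).
Proof.
move=> s0; apply: (wsqB_lty c_ge0).
  apply: (wsqD_lty c_ge0); apply: (wsqZ_lty c_ge0).
    exact/app_l2/dom_p.
  exact/dom_l2/dom_p.
exact/(wsqZ_lty c_ge0)/GuLu_l2.
Qed.

Let gap_left s : 0 < s -> wcvg m (F := s^'-) gap (gap s).
Proof.
move=> s0; apply: (wcvgB c_ge0); last first.
  have uE := dom_fin_energy (dom_u (ltW s0)).
  exact: (Gamma_wcvg m0_gt0 m_ge uE uE (grad_u_left s0) (grad_u_left s0)).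
apply: (wcvgZ c_ge0); first exact/dom_l2/dom_p/ltW.
  apply: cvg_at_left_filter; apply: (@continuous_comp _ _ _ (fun r => - 2 * K * r) expR).
    exact: mulrl_continuous.
  exact: continuous_expR.
exact: (semigroup_cont T_semigroup s0 (dom_l2 dom_Gf)).
Qed.

(* By CD, [w = Gamma(u)] is a weak solution of
   [laplacian w >= 2 K w + 2 Gamma(u, L u)]. *)
Let gap_dissip s : CD G K -> 0 <= s ->
  2 * K * l2_dot (negpart (gap s)) (negpart (gap s))
  <= l2_dot (gap_deriv s) (negpart (gap s)).
Proof.
move=> cd s0; set v := negpart (gap s).
have pl2 := dom_l2 (dom_p s0); have Lpl2 := app_l2 (dom_p s0).
pose hh x := 2 * K * w s x + 2 * Gamma (u s) (L (u s)) x.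
have hh_l2 : l2 hh.
  by apply: (wsqD_lty c_ge0); apply: (wsqZ_lty c_ge0); [exact: w_l2|exact: GuLu_l2].
have hh_le x : hh x <= laplacian (w s) x.
  have := cd (u s) x; rewrite /Gamma2 -(generator_laplacian etaP L_generator (dom_u s0)).
  by rewrite /hh /w; lra.
(* This brings the gap, hence its negative part, into [DQ], where it can serve as a test
   function. *)
have wE : fin_energy (w s).
  by apply: (caccioppoli etaP (w_l2 s0) hh_l2 _ hh_le) => x; exact: Gamma_ge0.
have wDQ : DQ (w s) by apply/(DQP etaP); split=> //; exact: w_l2.
have pE := dom_fin_energy (dom_p s0).
have gradgap : grad (gap s) = (fun q => e s * grad (p s) q) \- grad (w s).
  by apply/funext => q; rewrite /grad /gap /=; ring.
have epE : (wsq mu2 (fun q => e s * grad (p s) q)%R < +oo)%E by exact: (wsqZ_lty mu2_ge0).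
have gapDQ : DQ (gap s).
  apply/(DQP etaP); split; first exact: gap_l2.
  by rewrite gradgap; exact: (wsqB_lty mu2_ge0).
have vDQ : DQ v by exact: (DQ_negpart etaP gapDQ).
have /(DQP etaP)[vl2 vE] := vDQ.
have weak := weak_laplacian_ge etaP hh_l2 wDQ hh_le vDQ (negpart_ge0 (gap s)).
have Qgap : Q (gap s) v = e s * Q (p s) v - Q (w s) v.
  by rewrite !QE gradgap (wdotBl mu2_ge0 epE wE vE) (wdotZl mu2_ge0 _ pE vE); ring.
have Lp : l2_dot (L (p s)) v = - Q (p s) v.
  exact: (generator_form L_generator (dom_p s0) vDQ).
have vv : l2_dot v v = - (e s * l2_dot (p s) v - l2_dot (w s) v).
  rewrite -[l2_dot (p s) v]/(wdot m _ _) -[l2_dot (w s) v]/(wdot m _ _).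
  have epl2 := wsqZ_lty c_ge0 (e s) pl2.
  rewrite -(wdotZl c_ge0 _ pl2 vl2) -(wdotBl c_ge0 epl2 (w_l2 s0) vl2) -wdotNl.
  congr usum; apply/funext => x; rewrite -!mulrA negpart_sqE; congr (_ * _).
  by rewrite mulNr.
have dotD (a b : G -> R) : l2 a -> l2 b ->
    l2_dot (fun x => a x + b x) v = l2_dot a v + l2_dot b v.
  by move=> al2 bl2; exact: (wdotDl c_ge0 al2 bl2 vl2).
have dotZ k (a : G -> R) : l2 a -> l2_dot (fun x => k * a x) v = k * l2_dot a v.
  by move=> al2; exact: (wdotZl c_ge0 k al2 vl2).
have l2Z k (a : G -> R) : l2 a -> l2 (fun x => k * a x) by exact: (wsqZ_lty c_ge0).
have l2D (a b : G -> R) : l2 a -> l2 b -> l2 (fun x => a x + b x) by exact: (wsqD_lty c_ge0).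
have G_l2 := GuLu_l2 s0; have wl2 := w_l2 s0.
have derivE : l2_dot (gap_deriv s) v = e s * l2_dot (L (p s)) v
    + - 2 * K * e s * l2_dot (p s) v + - 2 * l2_dot (Gamma (u s) (L (u s))) v.
  rewrite (_ : gap_deriv s = fun x => (e s * L (p s) x + - 2 * K * e s * p s x)
      + - 2 * Gamma (u s) (L (u s)) x); last first.
    by apply/funext => x; rewrite /gap_deriv; ring.
  have Lp2 := l2Z (e s) _ Lpl2; have p2 := l2Z (- 2 * K * e s) _ pl2.
  rewrite (dotD _ _ (l2D _ _ Lp2 p2) (l2Z _ _ G_l2)) (dotD _ _ Lp2 p2).
  by rewrite (dotZ _ _ Lpl2) (dotZ _ _ pl2) (dotZ _ _ G_l2).
have hhE : l2_dot hh v = 2 * K * l2_dot (w s) v + 2 * l2_dot (Gamma (u s) (L (u s))) v.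
  rewrite (dotD _ _ (l2Z (2 * K) _ wl2) (l2Z 2 _ G_l2)).
  by rewrite (dotZ _ _ wl2) (dotZ _ _ G_l2).
have Qle : Q (gap s) v <= 0 by exact: Q_negpart_le0.
(* The weak inequality replaces the [Gamma (u s) (L (u s))] term, leaving
   [- Q (gap s) v - 2 K <gap s, v>] as a lower bound; here [<gap s, v> = - |v|^2]. *)
rewrite derivE vv Lp; move: weak Qle; rewrite hhE Qgap.
lra.
Qed.

Lemma CD_gap_ge0 : CD G K -> forall t, 0 <= t -> forall x, 0 <= gap t x.
Proof.
move=> cd t t0 x; apply: (maximum_principle gap_l2 gap_deriv_l2 gap_left gap_rderiv) => //.
- by move=> s s0; exact: gap_dissip.
- by move=> y; rewrite gap0.
Qed.

End C0Initial.

End GradientBound.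

(** * Localization and the equivalence *)

Lemma Gamma2_local (R : realType) (G : weightedGraph R) (f : G -> R) (x : G) :
  exists2 g : G -> R, C0 g &
    Gamma2 f x = Gamma2 g x /\ Gamma f f x = Gamma g g x.
Proof.
pose B1 := (x |` nbrs x)%fset; pose B2 := (B1 `|` \bigcup_(y <- B1) nbrs y)%fset.
pose g y : R := if y \in B2 then f y else 0.
have fgB1 y : y \in B1 -> f y = g y by move=> yB; rewrite /g in_fsetU yB.
have fgB2 y z : y \in B1 -> edge y z -> f z = g z.
  move=> yB yz; rewrite /g in_fsetU; case: ifPn => //.
  rewrite negb_or => /andP[_ /negP[]]; apply/bigfcupP; exists y; first by rewrite yB.
  by rewrite in_nbrs.
have xB1 : x \in B1 by rewrite in_fsetU in_fset1 eqxx.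
have yB1 y : edge x y -> y \in B1 by rewrite in_fsetU in_nbrs orbC => ->.
have LapE y : y \in B1 -> laplacian f y = laplacian g y.
  by move=> yB; apply: laplacian_local => [|z]; [exact: fgB1|exact: fgB2].
have GamE y : y \in B1 -> Gamma f f y = Gamma g g y.
  by move=> yB; apply: Gamma_local; (try exact: fgB1) => z; exact: fgB2.
exists g; first by apply/C0P; exists B2 => y /negbTE yB; rewrite /g yB.
split; last exact: GamE.
rewrite /Gamma2; congr (_ * _ - _).
  by apply: laplacian_local => [|y /yB1]; exact: GamE.
by apply: Gamma_local => [||y /yB1|y /yB1]; (try exact: fgB1); exact: LapE.
Qed.

Unset Implicit Arguments.

Theorem theorem4p1 (R : realType) (G : weightedGraph R)
    (L : l2_operator G) (T : R -> (G -> R) -> G -> R) (K : R)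
    (G_complete : complete_graph G) (m_nondegenerate : nondegenerate_measure G)
    (L_generator : form_generator L) (T_semigroup : exp_semigroup L T) :
  [<-> CD G K;
       forall f : G -> R, C0 f -> forall t : R, 0 <= t -> forall x : G,
         Gamma (heat T t f) (heat T t f) x
           <= expR (- 2 * K * t) * heat T t (Gamma f f) x;
       forall f : G -> R, DQ f -> forall t : R, 0 <= t -> forall x : G,
         Gamma (heat T t f) (heat T t f) x
           <= expR (- 2 * K * t) * heat T t (Gamma f f) x].
Proof.
have [eta etaP] := complete_graph_cutoff G_complete.
have [m0 m0_gt0 m_ge] := nondegenerate_measureP m_nondegenerate.
have heatT f t : l2 f -> 0 <= t -> heat T t f = T t f.
  exact: (heatE etaP L_generator T_semigroup).
tfae.
- move=> cd f f0 t t0 x.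
  rewrite (heatT _ _ (l2_C0 f0) t0) (heatT _ _ (l2_C0 (C0_Gamma f0)) t0) -subr_ge0.
  exact: (CD_gap_ge0 etaP m0_gt0 m_ge L_generator T_semigroup f0 cd t0 x).
- move=> bound f /(DQP etaP)[fl2 fE] t t0 x.
  have Gf_l2 := Gamma_l2 m0_gt0 m_ge fE fE.
  rewrite !heatT//.
  pose fk k y := eta k y * f y.
  have fk_C0 k : C0 (fk k) by exact/C0_mull/(cutoff_C0 etaP).
  (* On the left pointwise convergence suffices, [Gamma] at [x] being a finite sum; on the right
     [Gamma (fk k) (fk k)] must converge in [l2], since [T t] is applied to it. *)
  have lim_l : Gamma (T t (fk k)) (T t (fk k)) x @[k --> \oo] --> Gamma (T t f) (T t f) x.
    by apply: Gamma_cvg => y; exact: (semigroup_cutoff_cvg etaP T_semigroup).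
  have lim_r : expR (- 2 * K * t) * T t (Gamma (fk k) (fk k)) x @[k --> \oo] -->
      expR (- 2 * K * t) * T t (Gamma f f) x.
    apply: cvgMr; have grad_lim := cutoff_grad_wcvg etaP fl2 fE.
    have Gfk_l2 k : l2 (Gamma (fk k) (fk k)) by exact/l2_C0/C0_Gamma.
    exact: (wcvg_at (@m_ge0 _ G) (m_gt0 x) (semigroup_wcvg T_semigroup t0 Gf_l2 Gfk_l2
      (Gamma_wcvg m0_gt0 m_ge fE fE grad_lim grad_lim))).
  apply: (ler_cvg_to lim_l lim_r); apply: nearW => k.
  have := bound _ (fk_C0 k) t t0 x.
  by rewrite (heatT _ _ (l2_C0 (fk_C0 k)) t0) (heatT _ _ (l2_C0 (C0_Gamma (fk_C0 k))) t0).
- move=> bound f x; have [g g0 [-> ->]] := Gamma2_local f x.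
  apply: (gap_ge0_CD etaP m0_gt0 m_ge L_generator T_semigroup g0) => t t0 y.
  have := bound g (C0_DQ etaP g0) t t0 y.
  rewrite (heatT _ _ (l2_C0 g0) t0) (heatT _ _ (l2_C0 (C0_Gamma g0)) t0).
  by rewrite -subr_ge0.
Qed.
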